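(* Let $d\ge1$ and let $$\mathcal{C}(z_1,\dots,z_d,t)=\frac{1}{1-z_1t-z_2t^2-\cdots-z_dt^d-\frac{t^{d+1}}{1-t}}.$$ As $n\to\infty$, the maximum coefficient of $[t^n]\mathcal{C}(\mathbf{z},t)$ as a polynomial in $z_1,\dots,z_d$ approaches $$A_n=2^nn^{-d/2}\frac{2^{\frac{d^2}{4}+\frac{7d}{4}+1}}{2(2\pi)^{d/2}\sqrt{(d^2+4d+6)2^d-2}},$$ and $$\sup_{s_1,\dots,s_d\in\mathbb{N}}\left|\frac{[z_1^{s_1}\cdots z_d^{s_d}t^n]\mathcal{C}(z_1,\dots,z_d,t)}{A_n}-\exp\left[-\frac{(\mathbf{s}-n\mathbf{m})\mathcal{H}^{-1}(\mathbf{s}-n\mathbf{m})^T}{2n}\right]\right|\to0,$$ where $\mathbf{s}=(s_1,\dots,s_d)$, $\mathbf{m}=\left(\frac14,\frac18,\dots,\frac{1}{2^{d+1}}\right)$, and $\mathcal{H}$ is the $d\times d$ matrix with off-diagonal entries $\mathcal{H}_{i,j}=-2^{-i-j-2}(i+j-3)$ and diagonal entries $\mathcal{H}_{j,j}=2^{-2(j+1)}(2^{j+1}-2j+3)$.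
   Context: $[t^n]$ denotes extraction of the coefficient of $t^n$ in a power series, and $[z_1^{s_1}\cdots z_d^{s_d}t^n]$ the coefficient of that monomial. Combinatorial interpretation (not needed for the statement): $[z_1^{s_1}\cdots z_d^{s_d}t^n]\mathcal{C}$ counts integer compositions of $n$ in which each $k\in\{1,\dots,d\}$ occurs exactly $s_k$ times. $\mathbb{N}=\{0,1,2,\dots\}$. *)

(* Defs.v *)
From HB Require Import structures.
From mathcomp Require Import all_boot all_order all_algebra.
                                                                   
From mathcomp Require Import -(notations) mpoly.
From mathcomp Require Import all_classical all_reals all_analysis.
Import Order.TTheory GRing.Theory Num.Theory.

Set Implicit Arguments.
Unset Strict Implicit.
Unset Printing Implicit Defensive.

Local Open Scope ring_scope.

                                                                                
                                                                                
                                                                                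
Record fps (A : Type) := Fps { coefs : nat -> A }.

Lemma fpsP (A : Type) (f g : fps A) : coefs f =1 coefs g -> f = g.
Proof. by case: f g => [f] [g] /= /funext ->. Qed.

HB.instance Definition _ (A : Type) := gen_eqMixin (fps A).
HB.instance Definition _ (A : Type) := gen_choiceMixin (fps A).

Section FpsZmodule.
Variable A : zmodType.
Implicit Types f g h : fps A.

Definition fps_zero : fps A := Fps (fun=> 0).
Definition fps_opp f : fps A := Fps (fun n => - coefs f n).
Definition fps_add f g : fps A := Fps (fun n => coefs f n + coefs g n).

Let addA : associative fps_add.
Proof. by move=> f g h; apply: fpsP => n /=; rewrite addrA. Qed.
Let addC : commutative fps_add.
Proof. by move=> f g; apply: fpsP => n /=; rewrite addrC. Qed.
Let add0 : left_id fps_zero fps_add.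
Proof. by move=> f; apply: fpsP => n /=; rewrite add0r. Qed.
Let addN : left_inverse fps_zero fps_opp fps_add.
Proof. by move=> f; apply: fpsP => n /=; rewrite addNr. Qed.

HB.instance Definition _ := GRing.isZmodule.Build (fps A) addA addC add0 addN.

Lemma coefs0 n : coefs (0 : fps A) n = 0. Proof. by []. Qed.
Lemma coefsN f n : coefs (- f) n = - coefs f n. Proof. by []. Qed.
Lemma coefsD f g n : coefs (f + g) n = coefs f n + coefs g n.
Proof. by []. Qed.

End FpsZmodule.

Section FpsRing.
Variable A : comNzRingType.
Implicit Types f g h : fps A.

Definition fps_const (a : A) : fps A := Fps (fun n => if n is 0%N then a else 0).
Definition fps_t : fps A := Fps (fun n => (n == 1%N)%:R).
Definition fps_mul f g : fps A :=
  Fps (fun n => \sum_(i < n.+1) coefs f i * coefs g (n - i)).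

Let trunc N f : {poly A} := \poly_(i < N) coefs f i.

Let coef_trunc N f n : (n < N)%N -> (trunc N f)`_n = coefs f n.
Proof. by move=> nN; rewrite coef_poly nN. Qed.

Let coef_truncM N f g n : (n < N)%N ->
  (trunc N f * trunc N g)`_n = coefs (fps_mul f g) n.
Proof.
move=> nN; rewrite coefM /=; apply: eq_bigr => i _; rewrite !coef_trunc //.
  exact: leq_ltn_trans (leq_subr _ _) nN.
by apply: leq_trans nN; rewrite ltn_ord.
Qed.

Let mulC : commutative fps_mul.
Proof.
by move=> f g; apply: fpsP => n; rewrite -!(@coef_truncM n.+1) // mulrC.
Qed.

Let mulA : associative fps_mul.
Proof.
move=> f g h; apply: fpsP => n; pose T := trunc n.+1.
transitivity ((T f * T g * T h)`_n); rewrite -?mulrA.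
  rewrite coefM /=; apply: eq_bigr => i _.
  by rewrite coef_trunc ?ltn_ord// coef_truncM // ltnS leq_subr.
rewrite mulrA coefM /=; apply: eq_bigr => i _.
by rewrite coef_truncM ?ltn_ord// coef_trunc // ltnS leq_subr.
Qed.

Let mul1 : left_id (fps_const 1) fps_mul.
Proof.
move=> f; apply: fpsP => n /=; rewrite big_ord_recl /= mul1r subn0.
by rewrite big1 ?addr0 // => i _; rewrite mul0r.
Qed.

Let mulD : left_distributive fps_mul +%R.
Proof.
move=> f g h; apply: fpsP => n /=; rewrite -big_split /=.
by apply: eq_bigr => i _; rewrite mulrDl.
Qed.

Let one_neq0 : fps_const 1 != 0.
Proof. by apply/eqP => /(congr1 (fun f => coefs f 0)) /eqP; rewrite oner_eq0. Qed.

HB.instance Definition _ := GRing.Zmodule_isComNzRing.Build (fps A)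
  mulA mulC mul1 mulD one_neq0.

Lemma coefs1 n : coefs (1 : fps A) n = (n == 0%N)%:R. Proof. by case: n. Qed.
Lemma coefsM f g n :
  coefs (f * g) n = \sum_(i < n.+1) coefs f i * coefs g (n - i).
Proof. by []. Qed.

End FpsRing.

Arguments fps_t {A}.

Section FpsUnitRing.
Variable A : comUnitRingType.
Implicit Types f g : fps A.

Definition fps_unit : pred (fps A) := fun f => coefs f 0 \is a GRing.unit.

                                       
Fixpoint fps_inv_seq f n : seq A :=
  if n is k.+1 then
    let v := fps_inv_seq f k in
    rcons v ((coefs f 0)^-1 *
             ((k == 0%N)%:R - \sum_(i < k) nth 0 v i * coefs f (k - i)))
  else [::].

Definition fps_inv f : fps A :=
  if fps_unit f then Fps (fun n => nth 0 (fps_inv_seq f n.+1) n) else f.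

Let size_inv_seq f n : size (fps_inv_seq f n) = n.
Proof. by elim: n => //= n IHn; rewrite size_rcons IHn. Qed.

Let nth_inv_seq f n i : (i < n)%N ->
  nth 0 (fps_inv_seq f n) i = nth 0 (fps_inv_seq f i.+1) i.
Proof.
elim: n => // n IHn; rewrite ltnS leq_eqVlt => /orP[/eqP-> //|ltin].
by rewrite -IHn //= nth_rcons size_inv_seq ltin.
Qed.

Let mulV : {in fps_unit, left_inverse 1 fps_inv *%R}.
Proof.
move=> f fU; have f0U : coefs f 0 \is a GRing.unit by [].
apply: fpsP => n; rewrite coefsM coefs1 big_ord_recr subnn /=.
under eq_bigr => i _.
  have -> : coefs (fps_inv f) i = nth 0 (fps_inv_seq f n) i.
    by rewrite (nth_inv_seq f (ltn_ord i)) /fps_inv [fps_unit f]fU.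
  over.
have -> : coefs (fps_inv f) n = nth 0 (fps_inv_seq f n.+1) n.
  by rewrite /fps_inv [fps_unit f]fU.
by rewrite /= nth_rcons size_inv_seq ltnn eqxx mulrAC mulVr // mul1r addrC subrK.
Qed.

Let unitP f g : g * f = 1 -> fps_unit f.
Proof.
move=> /(congr1 (fun h => coefs h 0)); rewrite coefsM coefs1 big_ord1 /= => gf.
by apply/unitrPr; exists (coefs g 0); rewrite mulrC.
Qed.

Let inv_out : {in [predC fps_unit], fps_inv =1 id}.
Proof. by move=> f /negPf fNU; rewrite /fps_inv [fps_unit f]fNU. Qed.

HB.instance Definition _ := GRing.ComNzRing_hasMulInverse.Build (fps A)
  mulV unitP inv_out.

End FpsUnitRing.

                                                
Definition zvar (R : realType) (d : nat) (k : 'I_d) : mpoly d R :=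
  mpolyX R (mnm1 k).

Definition compGF (R : realType) (d : nat) : fps (mpoly d R) :=
  1 / (1 - \sum_(k < d) fps_const (zvar R k) * fps_t ^+ k.+1
         - fps_t ^+ d.+1 / (1 - fps_t)).

                                                                                
                                                                                
Definition maxcoef (R : realType) (d : nat) (p : mpoly d R) : R :=
  \big[Num.max/0]_(s <- msupp p) mcoeff s p.

Definition A_ (R : realType) (d n : nat) : R :=
  2 ^+ n * n%:R `^ (- (d%:R / 2)) *
  (2 `^ ((d ^ 2)%:R / 4 + 7 * d%:R / 4 + 1) /
   (2 * (2 * pi) `^ (d%:R / 2) *
    Num.sqrt ((d ^ 2 + 4 * d + 6)%:R * 2 ^+ d - 2))).

Definition svec (R : realType) (d : nat) (s : multinom d) : 'rV[R]_d :=
  \row_j (s j)%:R.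

                                                                              

Definition mvec (R : realType) (d : nat) : 'rV[R]_d := \row_j 2 ^- (j.+1 + 1).

Definition Hmx (R : realType) (d : nat) : 'M[R]_d :=
  \matrix_(i, j)
    if i == j
    then 2 ^- (2 * (j.+1 + 1)) * (2 ^+ (j.+1 + 1) - 2 * j.+1%:R + 3)
    else - 2 ^- (i.+1 + j.+1 + 2) * (i.+1%:R + j.+1%:R - 3).

Definition gauss (R : realType) (d n : nat) (s : multinom d) : R :=
  let v := svec R s - n%:R *: mvec R d in
  expR (- ((v *m invmx (Hmx R d) *m v^T) 0 0 / (2 * n%:R))).

(* Main.v *)
Require Import Defs.
From HB Require Import structures.
From mathcomp Require Import all_boot all_order all_algebra.
From mathcomp Require Import -(notations) mpoly.
From mathcomp Require Import all_classical all_reals all_analysis.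
From mathcomp Require Import measurable_realfun.
From mathcomp Require Import ring lra zify.
Import Order.TTheory GRing.Theory Num.Theory.
Import numFieldNormedType.Exports.

Set Implicit Arguments.
Unset Strict Implicit.
Unset Printing Implicit Defensive.

Local Open Scope classical_set_scope.
Local Open Scope ring_scope.

(** Writing the generating function as a geometric series in
    [z_1 t + ... + z_d t^d] and [t^(d+1)/(1-t)], the coefficient of [z^s t^n]
    is a sum over the number [j] of parts exceeding [d].  With
    [N_k = s_(k+1) + ... + s_d + j] for [k <= d] and [M = n - sum_(k<d) N_k],
    the [j]-th term divided by [2^n] is the product of the symmetric binomial
    probabilities [C(N_k, N_(k+1)) / 2^(N_k)] for [k < d] and of
    [C(M-1, j-1) / 2^M], because the exponents add up to [n].  Each factor obeys
    a local limit theorem (Stirling) and a Gaussian domination (Chernoff), so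
    the term is, uniformly and with a summable error,
    [c n^(-(d+1)/2) exp (- E / (2 n))] for a quadratic form [E] in the
    deviations of the [N_k] from [n / 2^(k+1)].  Completing the square in [j]
    splits [E] into [v H^-1 v^T], with [v = s - n m], plus a multiple of
    [(j - j0)^2]; summing over [j] is a Riemann sum for the Gaussian integral,
    which leaves the claimed density. *)

(** Where the fair binomials come from: [N_k] counts the parts larger than [k], and in a random
    composition each of them exceeds [k + 1] with probability about 1/2; hence also the means
    [n / 2^(k+1)]. Two uniformities shape the proof: the supremum runs over all [s], and up to
    [n + 1] values of [j] are summed. A local limit theorem for deviations of order [sqrt n] gives
    neither. So each comparison is combined with a Gaussian bound valid everywhere, and the
    resulting error keeps a Gaussian weight, which sums over [j] to [O(sqrt n)]. The matrix [H] is
    never inverted explicitly. Its rows give the vectors that represent the differences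
    [a k - a (k+1)] with respect to the quadratic form, so [H] is their Gram matrix and [v H^-1 v^T]
    is the minimum of the form over vectors with differences [v]. The constant of the binomial local
    limit first appears as an unidentified Stirling limit; the total mass 1 of the binomial
    distribution then determines it. *)

(** * Coefficients of powers and inverses of power series *)

Section FpsLemmas.
Variable A : comUnitRingType.
Implicit Types f g u : fps A.

Lemma coefs_sum I (r : seq I) (P : pred I) (F : I -> fps A) n :
  coefs (\sum_(i <- r | P i) F i) n = \sum_(i <- r | P i) coefs (F i) n.
Proof. by apply: (big_morph (fun f => coefs f n)) => // f g; rewrite coefsD. Qed.

Lemma coefs_constM a f n : coefs (fps_const a * f) n = a * coefs f n.
Proof.
rewrite coefsM big_ord_recl /= subn0 big1 ?addr0// => i _.
by rewrite mul0r.
Qed.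

Lemma coefs_tM f n : coefs (fps_t * f) n = if n is m.+1 then coefs f m else 0.
Proof.
rewrite coefsM; case: n => [|n]; first by rewrite big_ord1 mul0r.
rewrite 2!big_ord_recl /= mul0r add0r mul1r subn1 big1 ?addr0// => i _.
by rewrite mul0r.
Qed.

Lemma coefs_tXM k f n :
  coefs (fps_t ^+ k * f) n = if (k <= n)%N then coefs f (n - k) else 0.
Proof.
elim: k n => [|k IH] n; first by rewrite expr0 mul1r subn0.
by rewrite exprS -mulrA coefs_tM; case: n => // n; rewrite IH.
Qed.

Lemma coefs_exp_lt u k n : coefs u 0 = 0 -> (n < k)%N -> coefs (u ^+ k) n = 0.
Proof.
move=> u0; elim: k n => // k IH n nk; rewrite exprS coefsM.
rewrite big_ord_recl u0 mul0r add0r big1// => i _.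
by rewrite IH ?mulr0// lift0; have := ltn_ord i; lia.
Qed.

(** The tail [u^(n+1) / (1 - u)] of the geometric series has no term of degree at most [n], because
    [u] has no constant term. *)
Lemma coefs_inv_1B u n : coefs u 0 = 0 ->
  coefs (1 / (1 - u)) n = \sum_(k < n.+1) coefs (u ^+ k) n.
Proof.
move=> u0.
have U : (1 - u) \is a GRing.unit.
  by rewrite unfold_in /= /fps_unit coefsD coefsN coefs1 u0 subr0 unitr1.
have E : 1 / (1 - u) = \sum_(k < n.+1) u ^+ k + u ^+ n.+1 * (1 / (1 - u)).
  apply: (mulIr U); rewrite mulrDl -!mulrA mulVr// !mulr1.
  rewrite mulrC -opprB mulNr -subrX1 opprB.
  by rewrite subrK.
rewrite {1}E coefsD coefs_sum [X in _ + X](_ : _ = 0) ?addr0//.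
by rewrite coefsM big1// => i _; rewrite coefs_exp_lt// mul0r.
Qed.

(** The number of ways to write [r] as an ordered sum of [j] nonnegative integers; the empty sum
    [j = 0] has to be treated apart. *)
Definition bin_wt j r := if j is i.+1 then 'C(r + i, i) else nat_of_bool (r == 0)%N.

(** Multiplying by [1 - t] lowers [j] by one, which on coefficients is Pascal's rule. *)
Lemma coefs_inv_1Bt_exp j r : coefs ((1 - fps_t)^-1 ^+ j) r = (bin_wt j r)%:R :> A.
Proof.
have U : (1 - fps_t : fps A) \is a GRing.unit.
  by rewrite unfold_in /= /fps_unit coefsD coefsN coefs1 /= subr0 unitr1.
suff -> : (1 - fps_t)^-1 ^+ j = Fps (fun r => (bin_wt j r)%:R) :> fps A by [].
elim: j => [|j IH]; first by apply: fpsP => n; rewrite expr0 coefs1.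
apply: (mulrI U); rewrite exprS mulrA mulrV// mul1r IH.
apply: fpsP => n; rewrite mulrBl mul1r coefsD coefsN coefs_tM.
case: n => [|n] /=.
  by rewrite subr0; case: j {IH} => [|j] /=; rewrite ?add0n ?binn.
case: j {IH} => [|j] /=; first by rewrite !bin0 subrr.
rewrite (_ : 'C(n.+1 + j.+1, j.+1) = 'C(n.+1 + j, j) + 'C(n + j.+1, j.+1))%N.
  by rewrite natrD addrK.
by rewrite addSn binS addnC addnS addSn.
Qed.

End FpsLemmas.

Definition bin_prod d (f : nat -> nat) := (\prod_(k < d) 'C(f k, f k.+1))%N.

(** The identities [C(a, b) b! (a - b)! = a!] telescope along [f]: only the last factorial and those
    of the gaps survive. *)
Lemma bin_prod_fact d (f : nat -> nat) :
  (forall k, k < d -> f k.+1 <= f k)%N ->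
  (bin_prod d f * ((f d)`! * \prod_(k < d) (f k - f k.+1)`!) = (f 0)`!)%N.
Proof.
elim: d => [|d IH] fle; first by rewrite /bin_prod !big_ord0 muln1 mul1n.
rewrite -IH => [|k kd]; last by apply: fle; lia.
rewrite /bin_prod !big_ord_recr /= -(bin_fact (fle d _))//.
by rewrite -!mulnA; congr (_ * (_ * (_ * _)))%N; rewrite mulnC.
Qed.

(** * The coefficient as a sum over the number of large parts *)

Section Coefficient.
Variables (R : realType) (d : nat).
Implicit Types s : multinom d.

Definition tail_sum s k := (\sum_(l < d | k <= l) s l)%N.
Definition weight s := (\sum_(k < d) k.+1 * s k)%N.

Lemma tail_sum_ge s k : (d <= k)%N -> tail_sum s k = 0%N.
Proof. by move=> dk; rewrite /tail_sum big1// => l; have := ltn_ord l; lia. Qed.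

Lemma tail_sumS s (k : 'I_d) : tail_sum s k = (s k + tail_sum s k.+1)%N.
Proof.
rewrite /tail_sum (bigD1 k)//=; congr addn; apply: eq_bigl => l.
by rewrite -(inj_eq val_inj) /=; lia.
Qed.

Lemma tail_sum0 s : tail_sum s 0 = mdeg s.
Proof. by rewrite /tail_sum mdegE; apply: eq_bigl. Qed.

Lemma sum_tail_sum s : (\sum_(k < d) tail_sum s k = weight s)%N.
Proof.
rewrite /tail_sum /weight.
under eq_bigr do rewrite big_mkcond /=.
rewrite exchange_big /=; apply: eq_bigr => l _.
rewrite -big_mkcond /= sum_nat_const; congr muln.
have widen_ord_inj m p (mp : (m <= p)%N) : injective (widen_ord mp).
  by move=> x y /(congr1 val) /= xy; apply: val_inj.
rewrite -[RHS](card_ord l.+1) -[RHS](card_imset _ (@widen_ord_inj _ _ (ltn_ord l))).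
apply: eq_card => i; apply/idP/imsetP => [il|[x _ ->]] /=.
  have il' : (i < l.+1)%N by [].
  by exists (Ordinal il') => //; apply: val_inj.
by have := ltn_ord x.
Qed.

(** Identifies [bin_prod] of the tail sums with the multinomial coefficient of [s]. *)
Lemma multinomial_fact s :
  (bin_prod d (tail_sum s) * \prod_(k < d) (s k)`! = (mdeg s)`!)%N.
Proof.
rewrite -tail_sum0 -(@bin_prod_fact d (tail_sum s)) => [|k kd].
  rewrite tail_sum_ge// fact0 mul1n; congr muln.
  by apply: eq_bigr => k _; rewrite tail_sumS addnK.
by rewrite (tail_sumS _ (Ordinal kd)) leq_addl.
Qed.

Lemma mnm_sub1K s (k : 'I_d) : (0 < s k)%N ->
  mnm_add (mnm_sub s (mnm1 k)) (mnm1 k) = s.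
Proof.
move=> sk; apply/mnmP => i; rewrite mnmDE mnmBE mnm1E.
by case: eqP => [<-|_] /=; lia.
Qed.

(** Sorts the words with letter counts [s] by their first letter. After multiplication by the
    factorials it reduces to [mdeg s = sum_k s k]. *)
Lemma multinomial_pascal s : s != mnm0 ->
  (bin_prod d (tail_sum s) =
   \sum_(k < d | 0 < s k) bin_prod d (tail_sum (mnm_sub s (mnm1 k))))%N.
Proof.
move=> s0.
have P : (0 < \prod_(k < d) (s k)`!)%N by rewrite prodn_gt0// => k; rewrite fact_gt0.
apply/eqP; rewrite -(eqn_pmul2r P) multinomial_fact big_distrl /=; apply/eqP.
have mpos : (0 < mdeg s)%N by rewrite lt0n mdeg_eq0.
transitivity (\sum_(k < d | 0 < s k) s k * (mdeg s).-1`!)%N.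
  rewrite -big_distrl /= -{1}(prednK mpos) factS prednK//; congr muln.
  rewrite mdegE [RHS]big_mkcond /=; apply: eq_bigr => k _.
  by case: (s k).
apply: eq_bigr => k sk.
rewrite (bigD1 k)//= -{2}(prednK sk) factS prednK// -mulnA mulnCA; congr (_ * _)%N.
have -> : (mdeg s).-1 = mdeg (mnm_sub s (mnm1 k)).
  have := mdegD (mnm_sub s (mnm1 k)) (mnm1 k).
  by rewrite mnm_sub1K// mdeg1 => ->; rewrite addn1.
rewrite -multinomial_fact; congr muln.
rewrite (bigD1 k)//= mnmBE mnm1E eqxx subn1; congr (_ * _)%N.
apply: eq_bigr => i ik; rewrite mnmBE mnm1E.
by rewrite eq_sym (negbTE ik) subn0.
Qed.

Let Z : fps (mpoly d R) := \sum_(k < d) fps_const (zvar R k) * fps_t ^+ k.+1.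

Lemma coefs_ZM f n : coefs (Z * f) n =
  \sum_(k < d) zvar R k * (if (k.+1 <= n)%N then coefs f (n - k.+1) else 0).
Proof.
rewrite /Z mulr_suml coefs_sum; apply: eq_bigr => k _.
by rewrite -mulrA coefs_constM coefs_tXM.
Qed.

Lemma mcoeff_zvarM (k : 'I_d) (p : mpoly d R) s :
  mcoeff s (zvar R k * p) =
  if (0 < s k)%N then mcoeff (mnm_sub s (mnm1 k)) p else 0.
Proof.
rewrite mulrC /zvar; case: ifP => sk.
  by rewrite -{1}(mnm_sub1K sk) addmC mcoeffMX.
rewrite mcoeffMr big1// => -[[i Hi] [j Hj]] /= /eqP Es.
rewrite mcoeffX; case: eqP => [E|]; last by rewrite mulr0.
by move: sk; rewrite Es mnmDE -E mnm1E eqxx.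
Qed.

Lemma weight_sub s (k : 'I_d) : (0 < s k)%N ->
  (weight (mnm_sub s (mnm1 k)) + k.+1 = weight s)%N.
Proof.
move=> sk; rewrite /weight (bigD1 k)//= [RHS](bigD1 k)//= mnmBE mnm1E eqxx.
under eq_bigr => i ik do rewrite mnmBE mnm1E eq_sym (negbTE ik) subn0.
by set T := (\sum_(_ < _ | _) _)%N; clearbody T; nia.
Qed.

Lemma mdeg_sub s (k : 'I_d) : (0 < s k)%N ->
  (mdeg (mnm_sub s (mnm1 k)) + 1 = mdeg s)%N.
Proof.
by move=> sk; rewrite -{2}(mnm_sub1K sk) mdegD mdeg1.
Qed.

(** [Z^m] lists the words of [m] small parts; peeling off one factor [Z] is [multinomial_pascal]. *)
Lemma mcoeff_ZX m s n : mcoeff s (coefs (Z ^+ m) n) =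
  ((mdeg s == m) && (weight s == n))%:R * (bin_prod d (tail_sum s))%:R.
Proof.
elim: m s n => [|m IH] s n.
  rewrite expr0 coefs1 mdeg_eq0; case: eqP => [n0|n0]; last first.
    rewrite mcoeff0; case: eqP => [->|]; last by rewrite mul0r.
    have -> : weight (@mnm0 d) = 0%N.
      by rewrite /weight big1// => i _; rewrite mnm0E muln0.
    by case: eqP => [/esym|]; rewrite ?mul0r.
  rewrite mcoeff1; case: eqP => [->|]; last by rewrite mul0r.
  have -> : weight (@mnm0 d) = 0%N.
    by rewrite /weight big1// => i _; rewrite mnm0E muln0.
  rewrite n0 eqxx mul1r; congr (_%:R).
  have := @multinomial_fact mnm0; rewrite mdeg0 fact0.
  by move/eqP; rewrite muln_eq1 => /andP[/eqP ->].
rewrite exprS coefs_ZM raddf_sum /=.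
under eq_bigr => k _.
  rewrite mcoeff_zvarM (_ : (if (0 < s k)%N then _ else 0) =
    ((mdeg s == m.+1) && (weight s == n))%:R *
    (if (0 < s k)%N then (bin_prod d (tail_sum (mnm_sub s (mnm1 k))))%:R else 0)).
    over.
  case: ifP => sk; last by rewrite mulr0.
  rewrite -(weight_sub sk) -(mdeg_sub sk); case: ifP => kn.
    by rewrite IH; congr (_%:R * _); congr nat_of_bool; lia.
  rewrite mcoeff0 (_ : _ && _ = false) ?mul0r//.
  by apply/negP => /andP[_ /eqP]; lia.
rewrite -mulr_sumr; case: (boolP (mdeg s == m.+1)) => /= sm; last by rewrite !mul0r.
congr (_ * _); rewrite -big_mkcond /= multinomial_pascal ?natr_sum//.
by apply/eqP => s0; move: sm; rewrite s0 mdeg0.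
Qed.

(* The partial sum [N_k] of the header; [chain s j d = j]. *)
Definition chain s j k := (tail_sum s k + j)%N.

Lemma chain_end s j : chain s j d = j.
Proof. by rewrite /chain tail_sum_ge. Qed.

Lemma chainS s j (k : 'I_d) : chain s j k = (s k + chain s j k.+1)%N.
Proof. by rewrite /chain tail_sumS addnA. Qed.

Lemma sum_chain s j : (\sum_(k < d) chain s j k = weight s + d * j)%N.
Proof. by rewrite /chain big_split /= sum_tail_sum sum_nat_const card_ord. Qed.

(** The large parts act as one further letter with multiplicity [j], whose positions among the
    [mdeg s + j] parts are chosen by the extra binomial. *)
Lemma bin_prod_chain s j :
  (bin_prod d (chain s j) = 'C(mdeg s + j, j) * bin_prod d (tail_sum s))%N.
Proof.
have P : (0 < j`! * \prod_(k < d) (s k)`!)%N.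
  by rewrite muln_gt0 fact_gt0 prodn_gt0// => k; rewrite fact_gt0.
apply/eqP; rewrite -(eqn_pmul2r P); apply/eqP.
have <- : (\prod_(k < d) (chain s j k - chain s j k.+1)`! = \prod_(k < d) (s k)`!)%N.
  by apply: eq_bigr => k _; rewrite chainS addnK.
rewrite -{2}(chain_end s j) bin_prod_fact => [|k kd]; last first.
  by rewrite (chainS _ _ (Ordinal kd)) leq_addl.
have -> : (\prod_(k < d) (chain s j k - chain s j k.+1)`! = \prod_(k < d) (s k)`!)%N.
  by apply: eq_bigr => k _; rewrite chainS addnK.
have := multinomial_fact s; have := bin_fact (leq_addl (mdeg s) j).
rewrite addnK /chain tail_sum0 => <- <-.
by rewrite !mulnA; congr (_ * _)%N; lia.
Qed.

(* The number of compositions of M into j positive parts. *)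
Definition bin_last M j :=
  if M is M'.+1 then if j is j'.+1 then 'C(M', j') else 0%N else (j == 0%N) : nat.

(** Counts the compositions of [n] with small parts given by [s] and exactly [j] parts larger than
    [d]. Removing [d] from each large part leaves a composition of [n - weight s - d * j] into [j]
    positive parts; the test guards the truncated subtraction. *)
Definition comp_count n s j :=
  if (\sum_(k < d) chain s j k <= n)%N
  then (bin_prod d (chain s j) * bin_last (n - \sum_(k < d) chain s j k) j)%N
  else 0%N.

Let W : fps (mpoly d R) := fps_t ^+ d.+1 / (1 - fps_t).

Lemma coefs_WX j r : coefs (W ^+ j) r =
  (if (d * j <= r)%N then bin_last (r - d * j) j else 0%N)%:R.
Proof.
rewrite /W exprMn -exprM coefs_tXM coefs_inv_1Bt_exp.
case: ifP => [H|/negbT H].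
  rewrite ifT; last by lia.
  congr (_%:R); case: j H => [|j] H /=.
    by rewrite !muln0 !subn0; case: r {H}.
  have -> : (r - d * j.+1 = (r - d.+1 * j.+1 + j).+1)%N by lia.
  by [].
(* What remains is [d * j <= r < (d + 1) * j], too little for [j] positive parts, so [bin_last]
   vanishes. *)
case: ifP => // H'; case: j H H' => [|j] H H'; first by lia.
rewrite /bin_last; case E: (r - d * j.+1)%N => [|M] //.
by rewrite bin_small//; lia.
Qed.

Lemma mcoeff_ZXWX s n N j : (j <= N)%N ->
  mcoeff s (coefs (Z ^+ (N - j) * W ^+ j *+ 'C(N, j)) n) =
  (mdeg s + j == N)%:R * (comp_count n s j)%:R.
Proof.
move=> jN.
have coefsMn (f : fps (mpoly d R)) k : coefs (f *+ k) n = coefs f n *+ k.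
  by elim: k => // k IHk; rewrite !mulrS coefsD IHk.
rewrite coefsMn mcoeffMn coefsM raddf_sum /=.
under eq_bigr => i _ do rewrite coefs_WX mulr_natr mcoeffMn mcoeff_ZX.
rewrite /comp_count sum_chain.
have -> : (mdeg s == N - j)%N = (mdeg s + j == N)%N by lia.
case: eqP => [EN|_]; last first.
  rewrite [X in X *+ _]big1 ?mul0rn ?mul0r// => i _.
  by rewrite mul0r mul0rn.
rewrite mul1r /=.
case: (leqP (weight s) n) => wn; last first.
  rewrite ifN; last by lia.
  rewrite [X in X *+ _]big1 ?mul0rn// => i _.
  rewrite (_ : (_ == _) = false) ?mul0r ?mul0rn//.
  by apply/eqP; have := ltn_ord i; lia.
have wn' : (weight s < n.+1)%N by [].
rewrite (bigD1 (Ordinal wn'))//= eqxx mul1r big1; last first.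
  move=> i; rewrite -(inj_eq val_inj)/= eq_sym => /negbTE->.
  by rewrite mul0r mul0rn.
rewrite addr0 -!mulrnA bin_prod_chain EN.
rewrite (_ : (d * j <= n - weight s)%N = (weight s + d * j <= n)%N); last by lia.
rewrite subnDA; case: ifP => _; last by rewrite !muln0.
by congr (_%:R); nia.
Qed.

(** The geometric series is indexed by the number [N] of all parts and the binomial theorem for
    [(Z + W)^N] by the number [j] of large ones; only [N = mdeg s + j] contributes. *)
Lemma coef_compGF s n :
  mcoeff s (coefs (compGF R d) n) = \sum_(j < n.+1) (comp_count n s j)%:R.
Proof.
have -> : compGF R d = 1 / (1 - (Z + W)) by rewrite /compGF opprD addrA.
have W0 : coefs W 0 = 0 by rewrite /W coefs_tXM.
have Z0 : coefs Z 0 = 0.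
  by rewrite -[Z]mulr1 coefs_ZM big1// => k _; rewrite mulr0.
rewrite coefs_inv_1B; last by rewrite coefsD Z0 W0 addr0.
rewrite raddf_sum /=.
transitivity (\sum_(N < n.+1) \sum_(j < n.+1)
    (if (j < N.+1)%N then (mdeg s + j == N)%:R * (comp_count n s j)%:R else 0) : R).
  apply: eq_bigr => N _; rewrite exprDn coefs_sum raddf_sum /=.
  rewrite -big_mkcond /= -(big_ord_widen n.+1
    (fun j => (mdeg s + j == N)%:R * (comp_count n s j)%:R) (ltn_ord N)).
  by apply: eq_bigr => j _; rewrite mcoeff_ZXWX// -ltnS.
rewrite exchange_big /=; apply: eq_bigr => j _.
case: (leqP (mdeg s + j) n) => Hj.
  have Hj' : (mdeg s + j < n.+1)%N by [].
  rewrite (bigD1 (Ordinal Hj'))//= eqxx mul1r ifT; last by lia.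
  rewrite big1 ?addr0// => N; rewrite -(inj_eq val_inj)/= eq_sym => /negbTE->.
  by rewrite mul0r if_same.
(* Here [mdeg s + j > n]: there would be more parts than [n] allows. *)
rewrite (_ : comp_count n s j = 0%N).
  by rewrite big1// => N _; rewrite mulr0 if_same.
rewrite /comp_count sum_chain; case: ifP => // H.
have : (mdeg s <= weight s)%N.
  by rewrite mdegE /weight leq_sum// => k _; rewrite leq_pmull.
rewrite /bin_last => H2; case E: (n - _)%N => [|M].
  have -> : (nat_of_ord j == 0)%N = false by apply/eqP; nia.
  by rewrite muln0.
case: (nat_of_ord j) H E Hj => [|j'] H E Hj; first by rewrite muln0.
by rewrite bin_small ?muln0//; nia.
Qed.

End Coefficient.

(** * The quadratic form of the exponents and its relation to the matrix [H] *)

Section QuadraticForm.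
Variables (R : realType) (d : nat).
Implicit Types a b : nat -> R.

(* For [a k = N_k - n / 2^(k+1)] the linear forms below are the deviations
   [N_k - 2 N_(k+1)] and [2 j - M]. *)
Definition chain_form a b : R :=
  \sum_(k < d) 2 ^+ k.+1 * (a k - 2 * a k.+1) * (b k - 2 * b k.+1) +
  2 ^+ d * (2 * a d + \sum_(k < d) a k) * (2 * b d + \sum_(k < d) b k).

Lemma chain_formC a b : chain_form a b = chain_form b a.
Proof. by rewrite /chain_form; congr (_ + _); [apply: eq_bigr => k _|]; ring. Qed.

Lemma eq_chain_form a a' b b' :
  (forall k, (k <= d)%N -> a k = a' k) -> (forall k, (k <= d)%N -> b k = b' k) ->
  chain_form a b = chain_form a' b'.
Proof.
move=> aE bE; rewrite /chain_form (aE d)// (bE d)//; congr (_ + _ * (_ + _) * (_ + _)).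
- apply: eq_bigr => k _; have kd := ltn_ord k.
  by rewrite !aE ?bE//; lia.
- by apply: eq_bigr => k _; rewrite aE// ltnW.
- by apply: eq_bigr => k _; rewrite bE// ltnW.
Qed.

Lemma chain_formDr a b b' c :
  chain_form a (fun k => b k + c * b' k) = chain_form a b + c * chain_form a b'.
Proof.
rewrite /chain_form [c * (_ + _)]mulrDr [c * \sum_(k < d) _]mulr_sumr addrACA -big_split /=.
rewrite [\sum_(k < d) (b k + c * b' k)]big_split /= -mulr_sumr.
by congr (_ + _); [apply: eq_bigr => k _|]; ring.
Qed.

Lemma chain_form0r a : chain_form a (fun=> 0) = 0.
Proof.
rewrite /chain_form big1 => [|k _]; last by ring.
by rewrite [X in _ * (_ + X)]big1//; ring.
Qed.

Lemma chain_form_sumr a m (x : 'I_m -> R) (b : 'I_m -> nat -> R) :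
  chain_form a (fun k => \sum_i x i * b i k) = \sum_i x i * chain_form a (b i).
Proof.
rewrite [RHS](eq_bigr (fun i => \sum_(k < d) x i * (2 ^+ k.+1 * (a k - 2 * a k.+1) *
  (b i k - 2 * b i k.+1)) + x i * (2 ^+ d * (2 * a d + \sum_(k < d) a k) *
  (2 * b i d + \sum_(k < d) b i k)))); last first.
  by move=> i _; rewrite /chain_form mulrDr mulr_sumr.
rewrite big_split /= exchange_big /=; congr (_ + _).
  apply: eq_bigr => k _; rewrite mulr_sumr -sumrB mulr_sumr.
  by apply: eq_bigr => i _; ring.
rewrite exchange_big /= mulr_sumr -big_split /= mulr_sumr.
by apply: eq_bigr => i _; rewrite -mulr_sumr; ring.
Qed.

(** The form at the constant vector 1. Raising [j] by one with [s] fixed raises every [N_k] by one,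
    so this is the coefficient of the square in [j]; it is also the radicand in [A_n]. *)
Definition form_top : R := (d ^ 2 + 4 * d + 6)%:R * 2 ^+ d - 2.

Lemma chain_form_one : chain_form (fun=> 1) (fun=> 1) = form_top.
Proof.
rewrite /chain_form /form_top.
have -> : \sum_(k < d) (2 : R) ^+ k.+1 * (1 - 2 * 1) * (1 - 2 * 1) = 2 ^+ d.+1 - 2.
  elim: (d) => [|m IH]; first by rewrite big_ord0 expr1 subrr.
  by rewrite big_ord_recr /= IH !exprS; ring.
rewrite sumr_const card_ord exprS; ring.
Qed.

Lemma form_top_gt0 : 0 < form_top.
Proof.
have : 1 <= (2 : R) ^+ d by rewrite exprn_ege1// ler1n.
have : 0 <= (d ^ 2 + 4 * d)%:R :> R by [].
by rewrite /form_top natrD; nra.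
Qed.

(* The tails of the rows of [Hmx], extended by the entry pairing with the number
   of large parts. *)
Definition Hrow (i k : nat) : R :=
  (k <= i)%N%:R * 2 ^- i.+2 - 2 ^- (i + k + 3) * (k + i)%:R.

Lemma Hrow_diff (i k : 'I_d) : Hrow i k - Hrow i k.+1 = Hmx R d i k.
Proof.
rewrite mxE /Hrow -(inj_eq val_inj) /=.
have u2 : (2 : R) != 0 by rewrite pnatr_eq0.
case: (ltngtP i k) => [ik|ki|->].
- rewrite !mul0r.
  rewrite (_ : i + k.+1 + 3 = (i + k + 3).+1)%N; last by lia.
  rewrite (_ : i.+1 + k.+1 + 2 = (i + k + 3).+1)%N; last by lia.
  rewrite exprS.
  have : (2 : R) ^+ (i + k + 3) != 0 by rewrite expf_neq0.
  by move: (2 ^+ (i + k + 3)) => y y0; field.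
- rewrite mul1r.
  rewrite (_ : i + k.+1 + 3 = (i + k + 3).+1)%N; last by lia.
  rewrite (_ : i.+1 + k.+1 + 2 = (i + k + 3).+1)%N; last by lia.
  rewrite (exprS _ (i + k + 3)).
  have : (2 : R) ^+ (i + k + 3) != 0 by rewrite expf_neq0.
  move: (2 ^+ (i + k + 3)) => y y0.
  have : (2 : R) ^+ i.+2 != 0 by rewrite expf_neq0.
  by move: (2 ^+ i.+2) => z z0; field; rewrite z0 y0.
- rewrite mul1r mul0r.
  rewrite (_ : k + k.+1 + 3 = k.+2 + k.+2)%N; last by lia.
  rewrite (_ : 2 * (k.+1 + 1) = k.+2 + k.+2)%N; last by lia.
  rewrite addn1 (_ : k.+2 + k.+2 = (k + k + 3).+1)%N; last by lia.
  have e : (2 : R) ^+ (k + k + 3) * 2 = 2 ^+ k.+2 * 2 ^+ k.+2.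
    by rewrite -exprD -exprSr; congr (_ ^+ _); lia.
  have : (2 : R) ^+ (k + k + 3) = 2 ^+ k.+2 * 2 ^+ k.+2 / 2 by rewrite -e mulfK.
  rewrite (exprS _ (k + k + 3)) => ->.
  have : (2 : R) ^+ k.+2 != 0 by rewrite expf_neq0.
  by move: (2 ^+ k.+2) => z z0; field.
Qed.

Lemma Hrow_sum i m :
  \sum_(k < m) Hrow i k =
  ((minn m i.+1)%:R - i.+1%:R) * 2 ^- i.+2 + 2 ^- (i + m + 2) * (m + i.+1)%:R.
Proof.
have u2 : (2 : R) != 0 by rewrite pnatr_eq0.
elim: m => [|m IH].
  rewrite big_ord0 min0n addn0 add0n addn2.
  have : (2 : R) ^+ i.+2 != 0 by rewrite expf_neq0.
  by move: (2 ^+ i.+2) => z z0; field.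
rewrite big_ord_recr /= IH /Hrow.
rewrite (_ : i + m.+1 + 2 = (i + m + 2).+1)%N; last by lia.
rewrite (_ : i + m + 3 = (i + m + 2).+1)%N; last by lia.
have -> : (minn m.+1 i.+1)%:R = (minn m i.+1)%:R + (m <= i)%N%:R :> R.
  by rewrite -natrD; congr (_%:R); lia.
rewrite (exprS _ (i + m + 2)).
have : (2 : R) ^+ i.+2 != 0 by rewrite expf_neq0.
move: (2 ^+ i.+2) => z z0.
have : (2 : R) ^+ (i + m + 2) != 0 by rewrite expf_neq0.
by move: (2 ^+ (i + m + 2)) => y y0; field; rewrite z0 y0.
Qed.

(** The bracket is -1 for [k < i], 1 at [k = i] and 0 beyond; the weights [2^(k+1)] make the first
    range telescope. *)
Lemma chain_telescope a i m :
  \sum_(k < m) 2 ^+ k.+1 * ((k <= i)%N%:R - 2 * (k < i)%N%:R) * (a k - 2 * a k.+1) =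
  if (i < m)%N then 2 ^+ i.+2 * (a i - a i.+1) - 2 * a 0%N
  else 2 ^+ m.+1 * a m - 2 * a 0%N.
Proof.
elim: m => [|m IH]; first by rewrite big_ord0 expr1 subrr.
rewrite big_ord_recr /= IH ltnS; case: (ltngtP i m) => [im|mi|->].
- by rewrite mulr0 subr0 mulr0 mul0r addr0.
- by rewrite /= mulr1n !exprS; ring.
- by rewrite /= mulr1n !exprS; ring.
Qed.

(** The key to [H]: [Hrow i] represents the functional [a i - a (i+1)]. With [Hrow_diff] this makes
    [Hmx] the Gram matrix of the [Hrow i]. *)
Lemma chain_form_Hrow a (i : 'I_d) : chain_form a (Hrow i) = a i - a i.+1.
Proof.
have u2 : (2 : R) != 0 by rewrite pnatr_eq0.
pose y0 : R := 2 ^- i.+2.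
have e1 k : 2 ^+ k.+1 * (Hrow i k - 2 * Hrow i k.+1) =
    y0 * (2 ^+ k.+1 * ((k <= i)%N%:R - 2 * (k < i)%N%:R) + 1).
  rewrite /Hrow /y0 (_ : i + k.+1 + 3 = (i + k + 3).+1)%N; last by lia.
  rewrite (exprS _ (i + k + 3)); have -> : (2 : R) ^+ (i + k + 3) = 2 ^+ i.+2 * 2 ^+ k.+1.
    by rewrite -exprD; congr (_ ^+ _); lia.
  have : (2 : R) ^+ i.+2 != 0 by rewrite expf_neq0.
  move: (2 ^+ i.+2) => z z0.
  have : (2 : R) ^+ k.+1 != 0 by rewrite expf_neq0.
  by move: (2 ^+ k.+1) => y y1; field; rewrite z0 y1.
have e2 : 2 ^+ d * (2 * Hrow i d + \sum_(k < d) Hrow i k) = y0.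
  rewrite Hrow_sum /Hrow (_ : minn d i.+1 = i.+1); last by have := ltn_ord i; lia.
  rewrite subrr mul0r add0r leqNgt ltn_ord mul0r sub0r /y0.
  rewrite (_ : i + d + 3 = (i + d + 2).+1)%N; last by lia.
  have -> : (2 : R) ^+ (i + d + 2).+1 = 2 * (2 ^+ i.+2 * 2 ^+ d).
    by rewrite -exprD -exprS; congr (_ ^+ _); lia.
  have -> : (2 : R) ^+ (i + d + 2) = (2 ^+ i.+2 * 2 ^+ d).
    by rewrite -exprD; congr (_ ^+ _); lia.
  have : (2 : R) ^+ i.+2 != 0 by rewrite expf_neq0.
  move: (2 ^+ i.+2) => z z0.
  have : (2 : R) ^+ d != 0 by rewrite expf_neq0.
  by move: (2 ^+ d) => y y1; field; rewrite z0 y1.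
have -> : chain_form a (Hrow i) = y0 * (
    \sum_(k < d) 2 ^+ k.+1 * ((k <= i)%N%:R - 2 * (k < i)%N%:R) * (a k - 2 * a k.+1)
    + (\sum_(k < d) (a k - 2 * a k.+1) + (2 * a d + \sum_(k < d) a k))).
  rewrite /chain_form (mulrAC (2 ^+ d)) e2 addrA -big_split /= [RHS]mulrDr mulr_sumr.
  congr (_ + _); apply: eq_bigr => k _.
  by rewrite mulrAC e1; ring.
(* This boundary term cancels the [- 2 * a 0] left by [chain_telescope]. *)
have -> : \sum_(k < d) (a k - 2 * a k.+1) + (2 * a d + \sum_(k < d) a k) = 2 * a 0%N.
  elim: (d) => [|m IH]; first by rewrite !big_ord0; ring.
  rewrite !big_ord_recr /= -IH; ring.
rewrite chain_telescope ltn_ord subrK mulrA /y0 mulVf ?mul1r//.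
Qed.

Lemma chain_form_shift a c :
  chain_form (fun k => a k + c) (fun k => a k + c) =
  chain_form a a + 2 * c * chain_form a (fun=> 1) + c ^+ 2 * form_top.
Proof.
have e b : chain_form b (fun k => a k + c) = chain_form b a + c * chain_form b (fun=> 1).
  by rewrite -chain_formDr; apply: eq_chain_form => // k _; rewrite mulr1.
set f := (fun k => a k + c) in e *.
rewrite (e f) (chain_formC f a) (chain_formC f (fun=> 1)) !e chain_form_one.
by rewrite (chain_formC (fun=> 1) a); ring.
Qed.

Definition Hcomb (x : 'rV[R]_d) k := \sum_i x 0 i * Hrow i k.

Lemma Hcomb_diff x (k : 'I_d) : Hcomb x k - Hcomb x k.+1 = (x *m Hmx R d) 0 k.
Proof.
rewrite /Hcomb -sumrB mxE; apply: eq_bigr => i _.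
by rewrite -mulrBr Hrow_diff.
Qed.

Lemma chain_form_Hcomb a x :
  chain_form a (Hcomb x) = \sum_(i < d) x 0 i * (a i - a i.+1).
Proof.
rewrite /Hcomb (chain_form_sumr a (fun i => x 0 i) (fun i => Hrow i)).
by apply: eq_bigr => i _; rewrite chain_form_Hrow.
Qed.

Lemma eq_diff_shift a b :
  (forall k : 'I_d, a k - a k.+1 = b k - b k.+1) ->
  forall k, (k <= d)%N -> a k = b k + (a d - b d).
Proof.
move=> ab k kd; rewrite -(subKn kd); move: (d - k)%N (leq_subr k d) => m.
elim: m => [|m IH] md; first by rewrite subn0; ring.
have kd' : (d - m.+1 < d)%N by lia.
have := ab (Ordinal kd'); rewrite /= (_ : (d - m.+1).+1 = d - m)%N; last by lia.
by rewrite IH ?(ltnW md)// => /eqP; rewrite subr_eq => /eqP ->; ring.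
Qed.

(** For [x] in the kernel, [Hcomb x] is constant. Pairing it with the constant 1 gives 0, and
    [form_top > 0] forces [Hcomb x = 0]; pairing with the indicator of [k <= i] then reads off
    [x_i = 0]. *)
Lemma Hmx_unit : Hmx R d \in unitmx.
Proof.
rewrite -row_free_unit -kermx_eq0; apply/eqP/row_matrixP => r; rewrite row0.
set x := row r _.
have xH : x *m Hmx R d = 0 by rewrite /x -row_mul mulmx_ker row0.
have E := @eq_diff_shift (Hcomb x) (fun=> 0).
have {}E k : (k <= d)%N -> Hcomb x k = 0 + Hcomb x d * 1.
  move=> kd; rewrite mulr1 (E _ k kd) ?subr0// => i.
  by rewrite Hcomb_diff xH mxE.
have c0 : Hcomb x d = 0.
  have := chain_form_Hcomb (fun=> 1) x.
  rewrite (eq_chain_form (a' := fun=> 1) (b' := fun k => 0 + Hcomb x d * 1))//.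
  rewrite (chain_formDr _ (fun=> 0) (fun=> 1)) chain_form_one.
  rewrite [RHS]big1; last by move=> i _; rewrite subrr mulr0.
  rewrite [chain_form _ _](_ : _ = 0); last first.
    exact: chain_form0r.
  move/eqP; rewrite add0r mulf_eq0 (gt_eqF form_top_gt0) orbF.
  by move/eqP.
apply/rowP => i; rewrite mxE.
have := chain_form_Hcomb (fun k => (k <= i)%N%:R) x.
rewrite (eq_chain_form (a' := fun k => (k <= i)%N%:R) (b' := fun=> 0))//; last first.
  by move=> k /E ->; rewrite c0 mul0r addr0.
rewrite [chain_form _ _](_ : _ = 0); last first.
  exact: chain_form0r.
rewrite (bigD1 i)//= leqnn ltnn subr0 mulr1 big1 => [|k]; first by rewrite addr0 mxE => <-; rewrite mxE.
rewrite -(inj_eq val_inj)/= => ki; rewrite leq_eqVlt (negbTE ki)/= subrr mulr0 //.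
Qed.

(** The last coordinate of the minimiser of [chain_form] among vectors with differences [v]. *)
Definition Hcenter (v : 'rV[R]_d) := Hcomb (v *m invmx (Hmx R d)) d.

Definition Hquad (v : 'rV[R]_d) := (v *m invmx (Hmx R d) *m v^T) 0 0.

(** Completing the square: a vector with differences [v] is [Hcomb (v H^-1)] plus a constant, and
    constants are orthogonal to every [Hcomb] because their differences vanish. *)
Lemma chain_form_Hquad a (v : 'rV[R]_d) :
  (forall k : 'I_d, a k - a k.+1 = v 0 k) ->
  chain_form a a = Hquad v + form_top * (a d - Hcenter v) ^+ 2.
Proof.
move=> av; rewrite /Hquad /Hcenter; set x := v *m invmx _.
have xH : x *m Hmx R d = v by rewrite /x mulmxKV// Hmx_unit.
have E := @eq_diff_shift a (Hcomb x).
have {}E k : (k <= d)%N -> a k = Hcomb x k + (a d - Hcomb x d).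
  by apply: E => i; rewrite Hcomb_diff xH av.
rewrite (eq_chain_form E E) chain_form_shift.
rewrite [chain_form _ (fun=> 1)]chain_formC !chain_form_Hcomb.
rewrite [X in 2 * _ * X]big1; last by move=> i _; rewrite subrr mulr0.
rewrite mulr0 addr0 mxE; congr (_ + _); last by ring.
by apply: eq_bigr => i _; rewrite Hcomb_diff xH [v^T _ _]mxE.
Qed.

(** Exhibits the minimiser, through which positivity and coercivity pass from [chain_form] to
    [Hquad] and [Hcenter]. *)
Lemma Hquad_center (v : 'rV[R]_d) :
  exists2 a : nat -> R, a d = Hcenter v & chain_form a a = Hquad v.
Proof.
exists (Hcomb (v *m invmx (Hmx R d))) => //.
rewrite (@chain_form_Hquad _ v) ?subrr ?expr0n ?mulr0 ?addr0// => k.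
by rewrite Hcomb_diff mulmxKV// Hmx_unit.
Qed.

Lemma chain_form_ge0 a : 0 <= chain_form a a.
Proof.
rewrite /chain_form addr_ge0 ?sumr_ge0// => [k _|];
  by rewrite -mulrA mulr_ge0 ?exprn_ge0// -expr2 sqr_ge0.
Qed.

Lemma chain_form_eps_le a k : (k < d)%N ->
  2 ^+ k.+1 * (a k - 2 * a k.+1) ^+ 2 <= chain_form a a.
Proof.
move=> kd; rewrite /chain_form (bigD1 (Ordinal kd))//= -!mulrA -!expr2 -addrA lerDl.
rewrite addr_ge0 ?sumr_ge0// => [i _|];
  by rewrite ?mulrA -?mulrA mulr_ge0 ?exprn_ge0// -?expr2 sqr_ge0.
Qed.

Lemma chain_form_eta_le a :
  2 ^+ d * (2 * a d + \sum_(k < d) a k) ^+ 2 <= chain_form a a.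
Proof.
rewrite /chain_form -!mulrA -!expr2 lerDr sumr_ge0// => i _.
by rewrite -mulrA mulr_ge0 ?exprn_ge0// -expr2 sqr_ge0.
Qed.

(** Each square in the form is at most [D^2]. The first [d] give [a k] close to [2^(d-k) a d], and
    the last one then controls [a d]. The constant is crude. *)
Lemma chain_form_coercive a (D : R) : 0 <= D -> chain_form a a <= D ^+ 2 ->
  forall k, (k <= d)%N -> `|a k| <= (d.+2%:R * 4 ^+ d) * D.
Proof.
move=> D0 aD.
have ge1 k : 1 <= (2 : R) ^+ k by rewrite exprn_ege1// ler1n.
have sq z m : 2 ^+ m * z ^+ 2 <= D ^+ 2 -> `|z| <= D.
  move=> H; rewrite -(@ler_sqr _ _ D) ?nnegrE// real_normK ?num_real//.
  by apply: le_trans H; rewrite ler_peMl ?sqr_ge0.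
have e1 k : (k < d)%N -> `|a k - 2 * a k.+1| <= D.
  by move=> kd; apply: (@sq _ k.+1); apply: le_trans (chain_form_eps_le a kd) aD.
have e2 : `|2 * a d + \sum_(k < d) a k| <= D.
  by apply: (@sq _ d); apply: le_trans (chain_form_eta_le a) aD.
have e3 m : (m <= d)%N -> `|a (d - m)%N - 2 ^+ m * a d| <= (2 ^+ m - 1) * D.
  elim: m => [|m IH] md; first by rewrite subn0 mul1r !subrr mul0r normr0.
  have kd : (d - m.+1 < d)%N by lia.
  have := e1 _ kd; rewrite (_ : (d - m.+1).+1 = d - m)%N; last by lia.
  have := IH (ltnW md); rewrite exprS !ler_norml => /andP[? ?] /andP[? ?].
  by apply/andP; split; nra.
have e4 k : (k <= d)%N -> `|a k - 2 ^+ (d - k) * a d| <= 2 ^+ d * D.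
  move=> kd; rewrite -{1}(subKn kd); apply: le_trans (e3 _ (leq_subr _ _)) _.
  rewrite ler_wpM2r//; apply: (@le_trans _ _ (2 ^+ (d - k))); first by rewrite gerBl.
  by rewrite ler_weXn2l// ?ler1n// leq_subr.
have ad : `|a d| <= (1 + d%:R * 2 ^+ d) * D.
  have H : `|\sum_(k < d) (a k - 2 ^+ (d - k) * a d)| <= d%:R * (2 ^+ d * D).
    apply: le_trans (ler_norm_sum _ _ _) _.
    apply: (@le_trans _ _ (\sum_(k < d) 2 ^+ d * D)).
      by apply: ler_sum => k _; rewrite e4// ltnW.
    by rewrite sumr_const card_ord mulr_natl.
  have H2 : 0 <= \sum_(k < d) (2 : R) ^+ (d - k).
    by apply: sumr_ge0 => k _; rewrite exprn_ge0.
  rewrite sumrB -mulr_suml in H.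
  set S := \sum_(k < d) a k in H e2; set Q := \sum_(k < d) _ in H H2.
  (* Replacing each [a k] by [2^(d-k) a d] in the last linear form leaves [a d] times a factor at
     least 2. *)
  have : `|a d * (2 + Q)| <= D + d%:R * (2 ^+ d * D).
    have -> : a d * (2 + Q) = (2 * a d + S) - (S - Q * a d) by ring.
    by apply: le_trans (ler_normB _ _) _; rewrite lerD.
  rewrite normrM (ger0_norm (addr_ge0 _ H2))// => H3.
  rewrite mulrDl mul1r -mulrA; apply: le_trans H3.
  by rewrite ler_peMr//; lra.
move=> k kd; have := e4 k kd => H.
have : `|a k| <= 2 ^+ d * D + 2 ^+ d * `|a d|.
  rewrite -[a k](subrK (2 ^+ (d - k) * a d)); apply: le_trans (ler_normD _ _) _.
  rewrite lerD// normrM ger0_norm ?exprn_ge0//.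
  by rewrite ler_wpM2r// ler_weXn2l// ?ler1n// leq_subr.
move=> H1; apply: le_trans H1 _.
have -> : (4 : R) ^+ d = 2 ^+ d * 2 ^+ d by rewrite -exprMn; congr (_ ^+ _); ring.
have := ler_wpM2l (exprn_ge0 d (ler0n R 2)) ad => H1.
apply: le_trans (lerD (lexx _) H1) _.
have := ge1 d; rewrite -(addn2 d) natrD; move: (2 ^+ d) => y y1.
have : 0 <= d%:R :> R by []. move: (d%:R : R) => t t0.
suff : 0 <= D * (y * (y - 1) * 2) by lra.
by rewrite mulr_ge0// mulr_ge0// mulr_ge0 ?subr_ge0//; lra.
Qed.

End QuadraticForm.

(** * Riemann sums of the Gaussian, uniformly in step and offset *)

Section GaussSum.
Variable R : realType.
Implicit Types x y h : R.
Local Notation gauss_fun := (@gauss_fun R).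

Let mu := @lebesgue_measure R.

(** The primitive vanishing at 0. Integrating from [-oo] and subtracting treats negative and
    positive [x] alike. *)
Definition gauss_prim x : R :=
  (\int[mu]_(t in `]-oo, x]) gauss_fun t)%R -
  (\int[mu]_(t in `]-oo, 0%R]) gauss_fun t)%R.

Lemma gauss_prim_derive x : is_derive x 1 gauss_prim (gauss_fun x).
Proof.
have fi y : mu.-integrable [set` `]-oo, y]] (EFin \o gauss_fun).
  by apply: (integrableS measurableT) => //; exact: integrableT_gauss.
pose F y := (\int[mu]_(t in `]-oo, y]) gauss_fun t)%R.
have [dF F'] : derivable F x 1 /\ (F^`())%classic x = gauss_fun x.
  apply: (@continuous_FTC1 R gauss_fun -oo%O x (x + 1)) => //.
  - by rewrite ltrDl.
  - by rewrite /= ltNyr.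
  - exact: continuous_gauss_fun.
have -> : gauss_fun x = gauss_fun x - 0 by rewrite subr0.
apply: is_deriveB; apply: DeriveDef => //.
by rewrite -derive1E.
Qed.

Lemma gauss_prim_derivable x : derivable gauss_prim x 1.
Proof. by case: (gauss_prim_derive x). Qed.

(** [gauss_prim y + gauss_prim (- y)] has derivative 0 because [gauss_fun] is even. *)
Lemma gauss_primN x : gauss_prim (- x) = - gauss_prim x.
Proof.
pose S y := gauss_prim y + gauss_prim (- y).
have dS y : is_derive y 1 S 0.
  have dn : is_derive y 1 (fun z : R => - z) (- 1) by exact: is_deriveN.
  have dp : is_derive (- y) 1 gauss_prim (gauss_fun y).
    have -> : gauss_fun y = gauss_fun (- y) by rewrite /gauss_fun sqrrN.
    exact: gauss_prim_derive.
  have H := @is_derive1_comp _ gauss_prim (fun z : R => - z) y _ _ dp dn.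
  have := @is_deriveD _ _ _ _ _ _ _ _ _ (gauss_prim_derive y) H.
  by rewrite mulrN1 subrr.
have S0 : S x = S 0 by exact: is_derive_0_is_cst.
move: S0; rewrite /S oppr0 /gauss_prim !subrr addr0 => /eqP.
by rewrite addrC addr_eq0 => /eqP.
Qed.

Lemma gauss_prim_MVT x y : x <= y ->
  exists2 c, x <= c <= y & gauss_prim y - gauss_prim x = gauss_fun c * (y - x).
Proof.
move=> xy; have [|c] := MVT_segment xy (fun z _ => gauss_prim_derive z).
  apply: derivable_within_continuous => z _.
  exact: gauss_prim_derivable.
by rewrite in_itv /= => cxy ->; exists c.
Qed.

Lemma gauss_prim_le : {homo gauss_prim : x y / x <= y}.
Proof.
move=> x y xy; have [c _ H] := gauss_prim_MVT xy.
by rewrite -subr_ge0 H mulr_ge0 ?subr_ge0// gauss_fun_ge0.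
Qed.

Lemma gauss_prim_cvg : gauss_prim x @[x --> +oo] --> Num.sqrt pi / 2.
Proof.
have /cvg_ex[l Fl] : cvg (gauss_prim x @[x --> +oo]).
  apply/cvg_ex; eexists; apply: nondecreasing_cvgr; first exact: gauss_prim_le.
  exists (Num.sqrt pi) => _ [x _ <-]; rewrite /gauss_prim lerBlDr.
  apply: (@le_trans _ _ (Num.sqrt pi)); last first.
    rewrite lerDl; apply: Rintegral_ge0 => // t _; exact: gauss_fun_ge0.
  rewrite -lee_fin -integralT_gauss /Rintegral fineK; last first.
    apply: integrable_fin_num => //; apply: (integrableS measurableT) => //.
    exact: integrableT_gauss.
  apply: ge0_subset_integral => //.
    by apply/measurable_EFinP; exact: measurable_gauss_fun.
  by move=> t _; rewrite lee_fin gauss_fun_ge0.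
have := @ge0_continuous_FTC2y R gauss_fun gauss_prim 0 l.
rewrite integral0y_gauss => H.
suff <- : l = Num.sqrt pi / 2 by [].
apply/eqP; rewrite -eqe H //.
- by rewrite /gauss_prim subrr sube0.
- by move=> x _; exact: gauss_fun_ge0.
- by apply: continuous_subspaceT; exact: continuous_gauss_fun.
- by move=> x _; exact: gauss_prim_derivable.
- apply: cvg_at_right_filter.
  by apply: differentiable_continuous; apply/derivable1_diffP;
    exact: gauss_prim_derivable.
- by move=> x _; rewrite derive1E (derive_val (is_derive := gauss_prim_derive x)).
Qed.

Lemma gauss_prim_le_sqrtpi x : gauss_prim x <= Num.sqrt pi / 2.
Proof.
apply: (cvgr_to_ge gauss_prim_cvg).
by near=> y; apply: gauss_prim_le; near: y; apply: nbhs_pinfty_ge; exact: num_real.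
Unshelve. all: by end_near. Qed.

(* The total variation of the Gaussian on ]-oo, x]. *)
Let gauss_var x := if x <= 0 then gauss_fun x else 2 - gauss_fun x.

Let gauss_var_bound x y : x <= y ->
  `|gauss_fun y - gauss_fun x| <= gauss_var y - gauss_var x.
Proof.
move=> xy; rewrite /gauss_var.
have ge1 z : gauss_fun z <= 1 by exact: gauss_fun_le1.
have mono z t : `|z| <= `|t| -> gauss_fun t <= gauss_fun z.
  move=> zt; rewrite /gauss_fun ler_expR lerN2 -(real_normK (num_real z)).
  by rewrite -(real_normK (num_real t)) ler_sqr ?nnegrE.
case: (leP y 0) => y0.
  rewrite (le_trans xy y0) ger0_norm // subr_ge0; apply: mono.
  by rewrite !ler0_norm ?lerN2// (le_trans xy).
case: (leP x 0) => x0.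
  by have := ge1 x; have := ge1 y; rewrite ler_norml => *; lra.
have /mono h : `|x| <= `|y| by rewrite !gtr0_norm.
by rewrite ler0_norm ?subr_le0//; lra.
Qed.

(** The error of a Riemann sum of step [h] is at most [h] times the total variation, which is 2 for
    the Gaussian; hence no dependence on [x] or [N]. *)
Lemma gauss_riemann h x N : 0 < h ->
  `|h * \sum_(j < N) gauss_fun (h * j%:R + x)
    - (gauss_prim (h * N%:R + x) - gauss_prim x)| <= 2 * h.
Proof.
move=> h0.
suff H : `|h * \sum_(j < N) gauss_fun (h * j%:R + x)
    - (gauss_prim (h * N%:R + x) - gauss_prim x)| <=
    h * (gauss_var (h * N%:R + x) - gauss_var x).
  apply: (le_trans H); rewrite mulrC ler_pM2r //.
  have b z : 0 <= gauss_var z <= 2.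
    rewrite /gauss_var; have := gauss_fun_ge0 z; have := gauss_fun_le1 z.
    by case: ifP => _ *; apply/andP; split; lra.
  by have /andP[? ?] := b (h * N%:R + x); have /andP[? ?] := b x; lra.
elim: N => [|N IH].
  by rewrite big_ord0 !mulr0 !add0r !subrr mulr0 oppr0 normr0.
have le : h * N%:R + x <= h * N.+1%:R + x.
  by rewrite lerD2r ler_pM2l// ler_nat.
have [c /andP[c1 c2] Ec] := gauss_prim_MVT le.
have e : h * N.+1%:R + x - (h * N%:R + x) = h by rewrite -natr1; ring.
rewrite big_ord_recr /= mulrDr.
set S := h * _ in IH *.
have -> : S + h * gauss_fun (h * N%:R + x) -
   (gauss_prim (h * N.+1%:R + x) - gauss_prim x) =
   (S - (gauss_prim (h * N%:R + x) - gauss_prim x)) +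
   h * (gauss_fun (h * N%:R + x) - gauss_fun c).
  move: Ec; rewrite e => /eqP; rewrite subr_eq => /eqP ->; ring.
apply: le_trans (ler_normD _ _) _.
rewrite normrM (gtr0_norm h0) (distrC _ (gauss_fun c)).
have H1 := gauss_var_bound c1; have H2 := gauss_var_bound c2.
have H2' := le_trans (normr_ge0 _) H2.
have : `|gauss_fun c - gauss_fun (h * N%:R + x)| <=
  gauss_var (h * N.+1%:R + x) - gauss_var (h * N%:R + x) by lra.
by move=> /(ler_wpM2l (ltW h0)) H3; lra.
Qed.

Lemma gauss_sum_le h x N : 0 < h ->
  h * \sum_(j < N) gauss_fun (h * j%:R + x) <= Num.sqrt pi + 2 * h.
Proof.
move=> h0; have := gauss_riemann x N h0; rewrite ler_norml => /andP[_ H].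
have := gauss_prim_le_sqrtpi (h * N%:R + x).
have := gauss_prim_le_sqrtpi (- x); rewrite gauss_primN; lra.
Qed.

Lemma gauss_sum_lim (e : R) : 0 < e -> exists X : R, forall h x N,
  0 < h -> x <= - X -> X <= h * N%:R + x ->
  `|h * \sum_(j < N) gauss_fun (h * j%:R + x) - Num.sqrt pi| <= e + 2 * h.
Proof.
move=> e0.
have /cvgrPdist_le/(_ (e / 2)) := gauss_prim_cvg.
move=> /(_ (divr_gt0 e0 (ltr0Sn _ 1)))[X [_ HX]].
exists (X + 1) => h x N h0 xX NX.
have := gauss_riemann x N h0; rewrite ler_norml => /andP[H1 H2].
have := HX (h * N%:R + x); have := HX (- x).
rewrite gauss_primN ler_norml => /(_ ltac:(lra))/andP[? ?].
rewrite ler_norml => /(_ ltac:(lra))/andP[? ?].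
by rewrite ler_norml; apply/andP; split; lra.
Qed.

End GaussSum.

(** * Second order expansion of the logarithm *)

Section LogExpansion.
Variable R : realType.
Implicit Types x : R.

(** The remainder has derivative [y^2 / (1 + y)], at most [2 x^2] in absolute value for
    [|y| <= |x| <= 1/2]; the mean value theorem supplies the last factor [|x|]. *)
Lemma ln_expansion x : `|x| <= 1 / 2 -> `|ln (1 + x) - x + x ^+ 2 / 2| <= 2 * `|x| ^+ 3.
Proof.
pose f x : R := ln (1 + x) - x + 2^-1 * (x * x).
have df (y : R) : -1 < y -> is_derive y 1 f (y ^+ 2 / (1 + y)).
  move=> y1; have y0 : 0 < 1 + y by lra.
  have d1 : is_derive y 1 (fun z : R => 1 + z) 1.
    by rewrite -[X in is_derive _ _ _ X]add0r; apply: is_deriveD.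
  have dl : is_derive y 1 (fun z => ln (1 + z)) (1 + y)^-1.
    have := @is_derive1_comp _ (@ln R) (fun z : R => 1 + z) y _ _ (is_derive1_ln y0) d1.
    by rewrite mulr1.
  have dq : is_derive y 1 (fun z : R => 2^-1 * (z * z)) y.
    have d2 : is_derive y 1 (fun z : R => z * z) (y * 1 + y * 1).
      exact: is_deriveM (is_derive_id y 1) (is_derive_id y 1).
    by apply: is_derive_eq (is_deriveZ 2^-1 d2) _; rewrite /GRing.scale /=; field.
  have := is_deriveD (is_deriveB dl (is_derive_id y 1)) dq.
  move=> H; apply: is_derive_eq H _.
  by field; rewrite gt_eqF.
have cf (y z : R) : -1 < y -> {within `[y, z], continuous f}.
  move=> y1; apply: derivable_within_continuous => t; rewrite in_itv /= => /andP[yt _].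
  by have [] := df _ (lt_le_trans y1 yt).
have f0 : f 0 = 0 by rewrite /f addr0 ln1; ring.
have mvt (y z : R) : -1 < y -> y <= z -> exists2 c, y <= c <= z &
    f z - f y = c ^+ 2 / (1 + c) * (z - y).
  move=> y1 yz; have dyz t : t \in `]y, z[ -> is_derive t 1 f (t ^+ 2 / (1 + t)).
    by rewrite in_itv /= => /andP[yt _]; apply: df; lra.
  have [c] := MVT_segment yz dyz (cf y z y1).
  by rewrite in_itv /= => ? ?; exists c.
have bnd (c : R) : `|c| <= `|x| -> `|x| <= 1 / 2 -> `|c ^+ 2 / (1 + c)| <= 2 * `|x| ^+ 2.
  move=> cx x12; have := le_trans cx x12; rewrite ler_norml => /andP[c1 c2].
  have c0 : 0 < 1 + c by lra.
  rewrite normrM normfV (gtr0_norm c0) normrX ler_pdivrMr//.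
  have : `|c| ^+ 2 <= `|x| ^+ 2 by rewrite ler_sqr ?nnegrE.
  have : 0 <= `|x| ^+ 2 by rewrite exprn_ge0.
  by move: (`|c| ^+ 2) (`|x| ^+ 2) => u w ? ?; nra.
move=> x12; have /ler_normlP[? ?] := x12; have -> : ln (1 + x) - x + x ^+ 2 / 2 = f x by rewrite /f; field.
have [c cx ->] : exists2 c, `|c| <= `|x| & f x = c ^+ 2 / (1 + c) * x.
  have [x0|x0] := leP 0 x.
    have := mvt 0 x; rewrite f0 !subr0 => /(_ ltac:(lra) x0)[c /andP[c0 cx] ->].
    by exists c => //; rewrite !ger0_norm.
  have := mvt x 0; rewrite f0 !sub0r => /(_ ltac:(lra) (ltW x0))[c /andP[c0 cx] H].
  exists c; first by rewrite !ler0_norm ?lerN2// ltW.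
  by rewrite -[LHS]opprK H mulrN opprK.
by rewrite normrM (exprSr _ 2) mulrA ler_wpM2r// bnd.
Qed.

End LogExpansion.

(** * Convergence of the Stirling sequence *)

Section Stirling.
Variable R : realType.

Definition stirling (n : nat) : R := ln n`!%:R - (n%:R + 1 / 2) * ln n%:R + n%:R.

(** The increment is of order [1 / n^2]; the bound is written as a difference so that it
    telescopes. *)
Lemma stirling_step n : (1 < n)%N ->
  `|stirling n.+1 - stirling n| <= 8 * n%:R^-1 - 8 * n.+1%:R^-1.
Proof.
move=> n1; have n0 : 0 < n%:R :> R by rewrite ltr0n; lia.
pose x : R := n%:R^-1.
have x0 : 0 < x by rewrite invr_gt0.
have x2 : x <= 1 / 2 by rewrite div1r lef_pV2 ?posrE// ler_nat.
have nx : n%:R = x^-1 :> R by rewrite invrK.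
have en : n.+1%:R = n%:R * (1 + x) :> R by rewrite -natr1 /x mulrDr mulr1 divff// gt_eqF.
have -> : stirling n.+1 - stirling n = 1 - (n%:R + 1 / 2) * ln (1 + x).
  rewrite /stirling factS natrM lnM ?posrE ?ltr0n ?fact_gt0//.
  rewrite en lnM ?posrE//; last by lra.
  by rewrite nx; field; rewrite gt_eqF.
have := @ln_expansion _ x; rewrite (gtr0_norm x0) => /(_ x2).
move: (ln _) => L; rewrite ler_norml => /andP[L1 L2].
have -> : 8 / n%:R - 8 / n.+1%:R = 8 * x ^+ 2 / (1 + x).
  by rewrite en nx; field; rewrite !gt_eqF//; lra.
rewrite nx ler_pdivlMr; last by lra.
pose th := (L - x + x ^+ 2 / 2) / x.
have EL : L = x - x ^+ 2 / 2 + th * x by rewrite /th divfK ?gt_eqF//; ring.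
have th1 : - (2 * x ^+ 2) <= th by rewrite /th ler_pdivlMr//; nra.
have th2 : th <= 2 * x ^+ 2 by rewrite /th ler_pdivrMr//; nra.
have -> : 1 - (x^-1 + 1 / 2) * L = x ^+ 2 / 4 - th * (1 + x / 2).
  by rewrite EL; field; rewrite gt_eqF.
have th3 : `|th| <= 2 * x ^+ 2 by rewrite ler_norml th1.
apply: (@le_trans _ _ ((x ^+ 2 / 4 + 2 * x ^+ 2 * (1 + x / 2)) * (1 + x))).
  rewrite ler_wpM2r//; first by lra.
  apply: le_trans (ler_normB _ _) _; rewrite [`|th * _|]normrM.
  rewrite (@ger0_norm _ (1 + x / 2)); last by lra.
  rewrite (@ger0_norm _ (x ^+ 2 / 4)) ?lerD2l ?ler_wpM2r//; first by lra.
  by rewrite divr_ge0 ?sqr_ge0.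
rewrite -subr_ge0.
have -> : 8 * x ^+ 2 - (x ^+ 2 / 4 + 2 * x ^+ 2 * (1 + x / 2)) * (1 + x) =
  x ^+ 2 * (8 - (1 / 4 + 2 + x) * (1 + x)) by field.
by rewrite mulr_ge0 ?sqr_ge0//; nra.
Qed.

Lemma stirling_cvg : cvgn stirling.
Proof.
(* Adding or subtracting the telescoping bound gives a nonincreasing and a nondecreasing sequence
   enclosing [stirling]. The shift by 2 meets the hypothesis [1 < n] of [stirling_step]. *)
pose w n : R := stirling n.+2 + 8 * n.+2%:R^-1.
pose w' n : R := stirling n.+2 - 8 * n.+2%:R^-1.
have step n : w n.+1 <= w n /\ w' n <= w' n.+1.
  have := @stirling_step n.+2 isT; rewrite ler_norml /w /w'.
  by move: (8 / n.+2%:R) (8 / n.+3%:R) => p q /andP[? ?]; split; lra.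
have ninc : nonincreasing_seq w by apply/nonincreasing_seqP => n; case: (step n).
have ndec : nondecreasing_seq w' by apply/nondecreasing_seqP => n; case: (step n).
have ww n : w' n <= w n.
  by rewrite /w /w' lerD2l ge0_cp// divr_ge0.
have cw : cvgn w.
  apply: nonincreasing_is_cvgn => //; exists (w' 0%N) => _ [n _ <-].
  exact: le_trans (ndec 0%N n (leq0n n)) (ww n).
have cv : (fun n => 8 * n.+2%:R^-1 : R) @ \oo --> (0 : R).
  rewrite -[X in _ --> X](mulr0 8); apply: cvgM; first exact: cvg_cst.
  by have := @cvg_harmonic R; rewrite -cvg_shiftS.
apply/cvg_ex; exists (limn w); rewrite -(cvg_shiftn 2).
have -> : [sequence stirling (n + 2)%N]_n = (fun n => w n - 8 * n.+2%:R^-1).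
  by apply/funext => n; rewrite /= addn2 /w addrK.
have H : (w n - 8 * n.+2%:R^-1) @[n --> \oo] --> limn w - 0 by exact: cvgB cw cv.
by rewrite subr0 in H; exact: H.
Qed.

Lemma stirling_bounded : exists2 U : R, 0 < U & forall n, `|stirling n| <= U.
Proof.
have /cvg_seq_bounded/pinfty_ex_gt0[U U0 /= HU] := stirling_cvg.
by exists U => // n; exact: HU.
Qed.

End Stirling.

(** * Symmetric binomial probabilities: tails, domination and local limit *)

Section Binomial.
Variable R : realType.

Definition binp (N k : nat) : R := 'C(N, k)%:R / 2 ^+ N.
Definition bdev (N k : nat) : R := N%:R - 2 * k%:R.

Lemma binp_ge0 N k : 0 <= binp N k.
Proof. by rewrite divr_ge0// exprn_ge0. Qed.

Lemma expR_le_quad (x : R) : x <= 1 / 2 -> expR x <= 1 + x + 2 * x ^+ 2.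
Proof.
move=> x2; have q0 : 0 < 1 + x + 2 * x ^+ 2 by have := sqr_ge0 (x + 1 / 4); nra.
have e0 := expR_gt0 x; have := expR_ge1Dx (- x); rewrite expRN => H.
have : (1 - x) * expR x <= 1.
  by have := ler_wpM2r (ltW e0) H; rewrite mulVf// gt_eqF.
have : 1 <= (1 + x + 2 * x ^+ 2) * (1 - x).
  suff : 0 <= x ^+ 2 * (1 - 2 * x) by nra.
  by rewrite mulr_ge0 ?sqr_ge0//; lra.
move=> h1 h2; have x1 : 0 < 1 - x by lra.
by rewrite -(ler_pM2r x1) [expR x * _]mulrC (le_trans h2).
Qed.

Lemma binp_chernoff N k : binp N k <= expR (- (bdev N k ^+ 2 / (8 * N%:R))).
Proof.
case: (leqP k N) => kN; last by rewrite /binp bin_small// mul0r expR_ge0.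
case: (posnP N) kN => [-> | N0] kN.
  move: kN; rewrite leqn0 => /eqP ->.
  by rewrite /binp bin0 expr0 divr1 mulr0 invr0 mulr0 oppr0 expR0.
have Np : 0 < N%:R :> R by rewrite ltr0n.
(* The minimiser of [2 N lam^2 - lam * bdev N k], the exponent obtained from Markov's inequality and
   [cosh lam <= exp (2 lam^2)]. *)
pose lam : R := bdev N k / (4 * N%:R).
have kN' : k%:R <= N%:R :> R by rewrite ler_nat.
have k0 : 0 <= k%:R :> R by [].
have /andP[lam1 lam2] : - (1 / 2) <= lam <= 1 / 2.
  by rewrite /lam ler_pdivlMr ?ler_pdivrMr /bdev; [|lra|lra]; apply/andP; split; lra.
have two : expR lam + expR (- lam) <= 2 * expR (2 * lam ^+ 2).
  have := @expR_le_quad lam lam2; have := @expR_le_quad (- lam) ltac:(lra).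
  by have := expR_ge1Dx (2 * lam ^+ 2); rewrite sqrrN; lra.
have sum : 'C(N, k)%:R * expR (lam * bdev N k) <= (expR lam + expR (- lam)) ^+ N.
  have kN1 : (k < N.+1)%N by [].
  rewrite exprDn (bigD1 (Ordinal kN1))//= -expRM_natr -expRM_natr -expRD.
  rewrite (_ : lam * (N - k)%:R + - lam * k%:R = lam * bdev N k); last first.
    by rewrite natrB// /bdev; ring.
  by rewrite mulr_natl lerDl sumr_ge0.
have {}sum : 'C(N, k)%:R * expR (lam * bdev N k) <= 2 ^+ N * expR (2 * lam ^+ 2 * N%:R).
  apply: (le_trans sum); rewrite expRM_natr -exprMn lerXn2r ?nnegrE//.
rewrite /binp ler_pdivrMr ?exprn_gt0//.
rewrite -(@ler_pM2r _ (expR (lam * bdev N k))) ?expR_gt0//.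
apply: (le_trans sum); rewrite [X in _ <= X]mulrAC -expRD [X in _ <= X]mulrC ler_pM2l ?exprn_gt0// ler_expR.
by rewrite le_eqVlt; apply/orP; left; apply/eqP; rewrite /lam; field; rewrite gt_eqF.
Qed.

(** With [x = bdev N k / N] one has [k = N (1 - x) / 2] and [N - k = N (1 + x) / 2]. The expansions
    of [ln (1 + x)] and [ln (1 - x)] produce [- N x^2 / 2], and [r] collects their errors and the
    terms without the factor [N]. *)
Lemma binp_stirling N k : (0 < N)%N -> `|bdev N k| <= N%:R / 4 ->
  exists2 r : R, `|r| <= 2 * (bdev N k ^+ 2 / N%:R) * (`|bdev N k| / N%:R)
                         + (bdev N k / N%:R) ^+ 2 &
  Num.sqrt N%:R * binp N k =
  expR (stirling R N - stirling R k - stirling R (N - k) + ln 2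
        - bdev N k ^+ 2 / (2 * N%:R) + r).
Proof.
move=> N0 dN; have Np : 0 < N%:R :> R by rewrite ltr0n.
pose x := bdev N k / N%:R.
have x4 : `|x| <= 1 / 4.
  by rewrite /x normrM normfV (gtr0_norm Np) ler_pdivrMr//; lra.
have Ex : bdev N k = N%:R * x by rewrite /x mulrC divfK// gt_eqF.
clearbody x.
have x2E : x ^+ 2 = `|x| ^+ 2 by rewrite real_normK// num_real.
have /ler_normlP[x1 x2] := x4.
have Ek : k%:R = N%:R * (1 - x) / 2 :> R by rewrite mulrBr -Ex /bdev; field.
have kp : 0 < k%:R :> R by rewrite Ek divr_gt0// mulr_gt0//; lra.
have kN : (k < N)%N.
  by rewrite -(ltr_nat R) Ek ltr_pdivrMr//; rewrite ltr_pM2l//; lra.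
have Ek' : (N - k)%:R = N%:R * (1 + x) / 2 :> R.
  by rewrite natrB 1?ltnW// Ek; field.
have Lk : ln k%:R = ln N%:R + ln (1 - x) - ln 2 :> R.
  by rewrite Ek ln_div ?posrE ?mulr_gt0// ?lnM ?posrE//; lra.
have Lk' : ln (N - k)%:R = ln N%:R + ln (1 + x) - ln 2 :> R.
  by rewrite Ek' ln_div ?posrE ?mulr_gt0// ?lnM ?posrE//; lra.
have := @ln_expansion _ x ltac:(lra).
have := @ln_expansion _ (- x); rewrite normrN sqrrN => /(_ ltac:(lra)).
set p := ln (1 + x) in Lk' *; set q := ln (1 - x) in Lk *.
move=> Hq Hp.
pose r := - (1 / 2) * (N%:R * ((1 + x) * (p - x + x ^+ 2 / 2) +
   (1 - x) * (q - - x + x ^+ 2 / 2)) + (p - x + x ^+ 2 / 2) + (q - - x + x ^+ 2 / 2)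
   - x ^+ 2).
exists r.
  have -> : 2 * (bdev N k ^+ 2 / N%:R) * (`|bdev N k| / N%:R) + (bdev N k / N%:R) ^+ 2 =
     2 * N%:R * `|x| ^+ 3 + x ^+ 2.
    rewrite Ex normrM (gtr0_norm Np) !exprMn x2E.
    by field; rewrite gt_eqF.
  rewrite x2E.
  move: Hp Hq; rewrite /r x2E; move: (p - x + _) (q - - x + _) => u w Hu Hw.
  have c4 : `|x| ^+ 3 <= 1 / 4 * `|x| ^+ 2 by rewrite exprS ler_wpM2r// exprn_ge0.
  have Hz : `|N%:R * ((1 + x) * u + (1 - x) * w)| <= N%:R * (4 * `|x| ^+ 3).
    rewrite normrM (gtr0_norm Np) ler_pM2l//; apply: le_trans (ler_normD _ _) _.
    rewrite !normrM (@gtr0_norm _ (1 + x)) ?(@gtr0_norm _ (1 - x)); try lra.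
    have := @ler_wpM2l _ (1 + x) ltac:(lra) _ _ Hu.
    by have := @ler_wpM2l _ (1 - x) ltac:(lra) _ _ Hw; lra.
  move: Hu Hw Hz c4; move: (_ * (_ + _ * w)) (`|x| ^+ 3) (`|x| ^+ 2) => z c e.
  rewrite !ler_norml => /andP[? ?] /andP[? ?] /andP[? ?] ?.
  by apply/andP; split; lra.
have Cp : 0 < 'C(N, k)%:R :> R by rewrite ltr0n bin_gt0 ltnW.
have Tp : 0 < Num.sqrt N%:R * binp N k.
  by rewrite mulr_gt0 ?sqrtr_gt0// divr_gt0// exprn_gt0.
rewrite -[LHS]lnK ?posrE//; congr expR.
rewrite lnM ?posrE ?sqrtr_gt0 ?divr_gt0 ?exprn_gt0//.
rewrite /binp ln_div ?posrE ?exprn_gt0// lnXn//.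
have -> : ln (Num.sqrt N%:R) = ln N%:R / 2 :> R.
  rewrite -powR12_sqrt ?ler0n// ln_powR; lra.
have -> : ln 'C(N, k)%:R = ln N`!%:R - ln k`!%:R - ln (N - k)`!%:R :> R.
  rewrite -(bin_fact (ltnW kN)) !natrM !lnM ?posrE ?mulr_gt0 ?ltr0n ?fact_gt0 ?bin_gt0 1?ltnW//.
  ring.
rewrite /stirling Lk Lk' Ek Ek' /r Ex -mulr_natr.
by field; rewrite gt_eqF.
Qed.

(** Near the centre Stirling already has the factor [1 / sqrt N]. Far away half of the Chernoff
    exponent absorbs [sqrt N], which leaves the 16. *)
Lemma binp_domination : exists2 C : R, 0 < C & forall N k,
  Num.sqrt N%:R * binp N k <= C * expR (- (bdev N k ^+ 2 / (16 * N%:R))).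
Proof.
have [U U0 HU] := stirling_bounded R.
exists (32 * 32 + expR (3 * U + ln 2 + 1)) => [|N k].
  by rewrite addr_gt0// expR_gt0.
case: (posnP N) => [->|N0].
  by rewrite sqrtr0 mul0r mulr_ge0 ?expR_ge0// addr_ge0// expR_ge0.
have Np : 0 < N%:R :> R by rewrite ltr0n.
(* On the range [N / 4] of [binp_stirling] the cubic remainder could cancel the main exponent
   [- bdev^2 / (2 N)]; up to [N / 8] it takes at most half of it. *)
have [dN|dN] := leP `|bdev N k| (N%:R / 8).
  have [|r Hr ->] := @binp_stirling N k N0; first lra.
  apply: (@le_trans _ _ (expR (3 * U + ln 2 + 1) *
      expR (- (bdev N k ^+ 2 / (16 * N%:R))))); last first.
    by rewrite ler_wpM2r ?expR_ge0// lerDr.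
  rewrite -expRD ler_expR.
  have := HU N; have := HU k; have := HU (N - k)%N; rewrite !ler_norml.
  move=> /andP[? ?] /andP[? ?] /andP[? ?].
  have /ler_normlP[_ {}Hr] := Hr.
  have H1 : `|bdev N k| / N%:R <= 1 / 8 by rewrite ler_pdivrMr//; lra.
  have H2 : (bdev N k / N%:R) ^+ 2 <= 1.
    rewrite -(real_normK (num_real (bdev N k / N%:R))) normrM normfV (gtr0_norm Np).
    by rewrite expr_le1// ?divr_ge0//; lra.
  have -> : bdev N k ^+ 2 / (2 * N%:R) = (bdev N k ^+ 2 / N%:R) / 2.
    by field; rewrite gt_eqF.
  have -> : bdev N k ^+ 2 / (16 * N%:R) = (bdev N k ^+ 2 / N%:R) / 16.
    by field; rewrite gt_eqF.
  have : 0 <= bdev N k ^+ 2 / N%:R by rewrite divr_ge0 ?sqr_ge0.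
  move: (bdev N k ^+ 2 / N%:R) (`|bdev N k| / N%:R) ((bdev N k / N%:R) ^+ 2) => A B C in Hr H1 H2 *.
  by move=> A0; nra.
apply: (@le_trans _ _ (32 * 32 * expR (- (bdev N k ^+ 2 / (16 * N%:R))))); last first.
  by rewrite ler_wpM2r ?expR_ge0// lerDl expR_ge0.
have -> : 32 * 32 * expR (- (bdev N k ^+ 2 / (16 * N%:R))) =
    32 * 32 * expR (bdev N k ^+ 2 / (16 * N%:R)) * expR (- (bdev N k ^+ 2 / (8 * N%:R))).
  by rewrite -[RHS]mulrA -expRD; congr (_ * expR _); field; rewrite gt_eqF.
apply: ler_pM; rewrite ?sqrtr_ge0 ?binp_ge0 ?binp_chernoff//.
have H : N%:R / (32 * 32) <= bdev N k ^+ 2 / (16 * N%:R).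
  rewrite ler_pdivlMr; last by lra.
  have : (N%:R / 8) ^+ 2 <= `|bdev N k| ^+ 2.
    by rewrite ler_sqr ?nnegrE//; exact: ltW.
  rewrite real_normK ?num_real//; nra.
apply: (@le_trans _ _ N%:R).
  rewrite -[X in _ <= X]sqr_sqrtr ?ler0n// expr2 ler_peMl ?sqrtr_ge0//.
  by rewrite -[X in X <= _]sqrtr1 ler_wsqrtr// ler1n.
have := expR_ge1Dx (bdev N k ^+ 2 / (16 * N%:R)); lra.
Qed.

(** The limit of [sqrt N * binp N k] at the centre, where three Stirling sequences with a common
    limit combine; [binp_const_sqr] evaluates it. *)
Definition binp_const : R := expR (ln 2 - limn (stirling R)).

Lemma binp_const_gt0 : 0 < binp_const. Proof. exact: expR_gt0. Qed.

(** An arbitrary filter is used because later [N] and [k] depend on a pair [(n, f)], and the filter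
    then carries the uniformity. For [|bdev| <= K sqrt N] the remainder of [binp_stirling] is
    [O(1 / sqrt N)]. *)
Lemma binp_ratio_cvg T (F : set_system T) (FF : Filter F) (N k : T -> nat) (K : R) :
  N @ F --> \oo ->
  (\forall t \near F, `|bdev (N t) (k t)| <= K * Num.sqrt ((N t)%:R : R)) ->
  Num.sqrt ((N t)%:R : R) * binp (N t) (k t) *
    expR (bdev (N t) (k t) ^+ 2 / (2 * (N t)%:R)) @[t --> F] --> binp_const.
Proof.
move=> Noo dK.
have NR : ((N t)%:R : R) @[t --> F] --> +oo%R by apply: (@cvg_comp _ _ _ N (fun n => n%:R : R) F \oo _ Noo); exact: cvgr_idn.
have yoo : Num.sqrt ((N t)%:R : R) @[t --> F] --> +oo%R.
  apply/cvgryPge => A; move/cvgryPge : NR => /(_ (A ^+ 2)); apply: filterS => t At.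
  by rewrite (le_trans (ler_norm _))// -sqrtr_sqr ler_wsqrtr.
have Npos : \forall t \near F, (0 < N t)%N.
  by move/cvgnyPge : Noo => /(_ 1%N).
have y0 : (Num.sqrt ((N t)%:R : R))^-1 @[t --> F] --> (0 : R).
  apply/gtr0_cvgV0 => //; apply: filterS Npos => t Nt.
  by rewrite sqrtr_gt0 ltr0n.
have dN : \forall t \near F, `|bdev (N t) (k t)| <= (N t)%:R / 4.
  move/cvgryPge : yoo => /(_ (4 * K)) H4; near=> t.
  have h1 : `|bdev (N t) (k t)| <= K * Num.sqrt ((N t)%:R : R) by near: t.
  have h2 : 4 * K <= Num.sqrt ((N t)%:R : R) by near: t.
  apply: (le_trans h1); rewrite -[X in X / 4]sqr_sqrtr ?ler0n//.
  by have := sqrtr_ge0 ((N t)%:R : R); nra.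
have koo : k @ F --> \oo.
  apply/cvgnyPge => A; move/cvgnyPge : Noo => /(_ (4 * A)%N) H4; near=> t.
  have : `|bdev (N t) (k t)| <= (N t)%:R / 4 by near: t.
  have : (4 * A <= N t)%N by near: t.
  rewrite -!(ler_nat R) natrM ler_norml /bdev => ? /andP[? ?]; lra.
have k'oo : (N t - k t)%N @[t --> F] --> \oo.
  apply/cvgnyPge => A; move/cvgnyPge : Noo => /(_ (4 * A)%N) H4; near=> t.
  have : `|bdev (N t) (k t)| <= (N t)%:R / 4 by near: t.
  have : (4 * A <= N t)%N by near: t.
  move=> H5; rewrite ler_norml /bdev => /andP[? ?].
  have H6 : 0 <= (N t)%:R :> R by [].
  have kN : (k t <= N t)%N by rewrite -(ler_nat R); lra.
  move: H5; rewrite -!(ler_nat R) natrM natrB//; lra.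
pose s t := stirling R (N t) - stirling R (k t) - stirling R (N t - k t) + ln 2.
have sc : s t @[t --> F] --> ln 2 - limn (stirling R).
  have -> : ln 2 - limn (stirling R) = limn (stirling R) - limn (stirling R)
    - limn (stirling R) + ln 2 by ring.
  have uc := @stirling_cvg R.
  apply: cvgD; last exact: cvg_cst.
  by apply: cvgB; [apply: cvgB|]; [apply: cvg_comp Noo uc|apply: cvg_comp koo uc|apply: cvg_comp k'oo uc].
pose f t := ln (Num.sqrt ((N t)%:R : R) * binp (N t) (k t) *
    expR (bdev (N t) (k t) ^+ 2 / (2 * (N t)%:R))) - s t.
pose g t := 2 * K ^+ 3 * (Num.sqrt ((N t)%:R : R))^-1 + K ^+ 2 * (Num.sqrt ((N t)%:R : R))^-1 ^+ 2.
have g0 : g t @[t --> F] --> 0.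
  have -> : 0 = 2 * K ^+ 3 * 0 + K ^+ 2 * 0 ^+ 2 :> R by ring.
  apply: cvgD; apply: cvgM; try exact: cvg_cst; first exact: y0.
  by apply: (@cvg_comp _ _ _ _ (fun z => z ^+ 2)) y0 _; exact: exprn_continuous.
have key : \forall t \near F, `|f t| <= g t /\
   Num.sqrt ((N t)%:R : R) * binp (N t) (k t) *
    expR (bdev (N t) (k t) ^+ 2 / (2 * (N t)%:R)) = expR (s t + f t).
  near=> t.
  have N0 : (0 < N t)%N by near: t.
  have Np : 0 < (N t)%:R :> R by rewrite ltr0n.
  have [|r Hr Er] := @binp_stirling (N t) (k t) N0; first by near: t.
  have Ef : Num.sqrt ((N t)%:R : R) * binp (N t) (k t) *
    expR (bdev (N t) (k t) ^+ 2 / (2 * (N t)%:R)) = expR (s t + r).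
    by rewrite Er -expRD; congr expR; rewrite /s; ring.
  have fr : f t = r by rewrite /f Ef expRK; ring.
  rewrite fr Ef; split=> //; apply: (le_trans Hr).
  have h1 : `|bdev (N t) (k t)| <= K * Num.sqrt ((N t)%:R : R) by near: t.
  set S := Num.sqrt ((N t)%:R : R) in h1 *.
  have S0 : 0 < S by rewrite sqrtr_gt0.
  have NS : (N t)%:R = S ^+ 2 by rewrite sqr_sqrtr// ler0n.
  have b1 : `|bdev (N t) (k t)| / (N t)%:R <= K * S^-1.
    rewrite NS ler_pdivrMr ?exprn_gt0//; apply: (le_trans h1).
    by rewrite le_eqVlt; apply/orP; left; apply/eqP; field; rewrite gt_eqF.
  have b2 : bdev (N t) (k t) ^+ 2 / (N t)%:R <= K ^+ 2.
    rewrite NS ler_pdivrMr ?exprn_gt0// -exprMn -(real_normK (num_real (bdev _ _))).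
    by rewrite lerXn2r// nnegrE ?(le_trans _ h1).
  have b3 : (bdev (N t) (k t) / (N t)%:R) ^+ 2 <= K ^+ 2 * S^-1 ^+ 2.
    rewrite -exprMn -(real_normK (num_real (_ / _))) normrM normfV (gtr0_norm Np).
    by rewrite lerXn2r// nnegrE; [exact: divr_ge0|apply: le_trans b1; exact: divr_ge0].
  rewrite /g -/S lerD// (_ : 2 * K ^+ 3 * S^-1 = 2 * K ^+ 2 * (K * S^-1)); last by ring.
  apply: ler_pM => //.
  - by rewrite mulr_ge0// divr_ge0// sqr_ge0.
  - by rewrite ler_wpM2l.
have f0 : f t @[t --> F] --> 0.
  apply: (@squeeze_cvgr _ _ _ _ (fun t => - g t) g) => //.
    by near=> t; rewrite -ler_norml; have [] := near key t _.
  by rewrite -oppr0; apply: cvgN.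
have : expR (s t + f t) @[t --> F] --> binp_const.
  apply: (@cvg_comp _ _ _ _ expR _ (nbhs (ln 2 - limn (stirling R)))).
    by have := cvgD sc f0; rewrite addr0; exact.
  exact: continuous_expR.
apply: cvg_trans; apply: near_eq_cvg; near=> t.
by apply/esym; have [] := near key t _.
Unshelve. all: by end_near. Qed.

End Binomial.

(** * From local limits to uniform weighted estimates *)

Section UniformLimit.
Variables (R : realType) (T : Type) (sz : T -> nat).

(* Eventually as the size grows, uniformly over the points of [D]. *)
Definition unif_oo (D : set T) : set_system T :=
  [set P | exists n0, forall t, (n0 <= sz t)%N -> D t -> P t].

Global Instance unif_oo_filter D : Filter (unif_oo D).
Proof.
split; first by exists 0%N.
- move=> P Q [n HP] [m HQ]; exists (maxn n m) => t; rewrite geq_max => /andP[nt mt] Dt.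
  by split; [exact: HP|exact: HQ].
- by move=> P Q PQ [n HP]; exists n => t nt Dt; apply: PQ; exact: HP.
Qed.

Lemma unif_oo_size D : sz @ unif_oo D --> \oo.
Proof. by apply/cvgnyPge => A; exists A. Qed.

Lemma unif_oo_in (D : set T) : \forall t \near unif_oo D, D t.
Proof. by exists 0%N. Qed.

Lemma ratio_to_diff (F : set_system T) (FF : Filter F) (f q : T -> R) (c : R) :
  (\forall t \near F, 0 <= q t) -> f t * expR (q t) @[t --> F] --> c ->
  (f t - c * expR (- q t)) @[t --> F] --> (0 : R).
Proof.
move=> q0 fc; apply/cvgr0Pnorm_le => e e0.
move/cvgrPdist_le : fc => /(_ e e0) fc; near=> t.
have qt : 0 <= q t by near: t.
have -> : f t - c * expR (- q t) = (f t * expR (q t) - c) * expR (- q t).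
  by rewrite mulrBl -mulrA -expRD subrr expR0 mulr1.
rewrite normrM (ger0_norm (expR_ge0 _)) distrC.
apply: (@le_trans _ _ `|c - f t * expR (q t)|); last by near: t.
by rewrite ler_piMr// expR_le1 oppr_le0.
Unshelve. all: by end_near. Qed.

(** Inside [q <= K] the local limit applies; outside, both functions are small. Only half of the
    decay rate is spent on making them small, so the error retains a Gaussian weight and can be
    summed. *)
Lemma dominated_patch (f g q : T -> R) (C c : R) : 0 < C -> 0 < c ->
  (forall t, 0 <= q t) ->
  (forall t, `|f t| <= C * expR (- (c * q t))) ->
  (forall t, `|g t| <= C * expR (- (c * q t))) ->
  (forall K, (f t - g t) @[t --> unif_oo [set t | q t <= K]] --> 0) ->
  forall e, 0 < e -> exists n0, forall t, (n0 <= sz t)%N ->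
    `|f t - g t| <= e * expR (- (c / 2 * q t)).
Proof.
move=> C0 c0 q0 Hf Hg fg e e0.
(* Makes [c / 2 * K = 2 C / e], so that [exp x >= 1 + x] yields [2 C exp (- c K / 2) <= e]. *)
pose K := 2 / c * (2 * C / e).
have HK : 2 * C * expR (- (c / 2 * K)) <= e.
  rewrite expRN ler_pdivrMr ?expR_gt0//.
  have -> : c / 2 * K = 2 * C / e by rewrite /K; field; rewrite !gt_eqF.
  have := expR_ge1Dx (2 * C / e) => /(ler_wpM2l (ltW e0)); apply: le_trans.
  by rewrite mulrDr mulr1 mulrCA divff ?gt_eqF// mulr1 lerDr ltW.
have e1 : 0 < e * expR (- (c / 2 * K)) by rewrite mulr_gt0// expR_gt0.
move/cvgr0Pnorm_le : (fg K) => /(_ _ e1)[n0 Hn0].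
exists n0 => t nt; have [qK|Kq] := leP (q t) K.
  apply: (le_trans (Hn0 t nt qK)); rewrite ler_wpM2l ?(ltW e0)// ler_expR lerN2.
  by rewrite ler_wpM2l// divr_ge0// ltW.
apply: le_trans (ler_normB _ _) _; apply: (le_trans (lerD (Hf t) (Hg t))).
have -> : - (c * q t) = - (c / 2 * q t) + - (c / 2 * q t) by field.
rewrite expRD -mulrDl mulrA ler_wpM2r ?expR_ge0//.
rewrite (_ : C + C = 2 * C); last by ring.
apply: le_trans HK; rewrite ler_wpM2l ?mulr_ge0 ?(ltW C0)// ler_expR lerN2.
by rewrite ler_wpM2l ?(ltW Kq)// divr_ge0// ltW.
Qed.

End UniformLimit.

(** * Sums of Gaussians over integers with an arbitrary centre *)

Section LatticeGauss.
Variable R : realType.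
Variable (al : R) (al0 : 0 < al).

Let lattice_gaussE (n : nat) (c : R) (j : nat) : (0 < n)%N ->
  expR (- (al * (j%:R - c) ^+ 2 / n%:R)) =
  gauss_fun (Num.sqrt (al / n%:R) * j%:R + - (Num.sqrt (al / n%:R) * c)).
Proof.
move=> n0; rewrite /gauss_fun -mulrBr exprMn sqr_sqrtr ?divr_ge0 ?(ltW al0)//.
by congr expR; field; rewrite pnatr_eq0 -lt0n.
Qed.

Let step_gt0 (n : nat) : (0 < n)%N -> 0 < Num.sqrt (al / n%:R).
Proof. by move=> n0; rewrite sqrtr_gt0 divr_gt0// ltr0n. Qed.

Let stepE (n : nat) : (0 < n)%N ->
  Num.sqrt (al / n%:R) = Num.sqrt al / Num.sqrt n%:R.
Proof. by move=> n0; rewrite sqrtrM ?(ltW al0)// sqrtrV. Qed.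

Lemma lattice_gauss_le : exists2 C : R, 0 < C & forall (n m : nat) (c : R), (0 < n)%N ->
  \sum_(j < m) expR (- (al * (j%:R - c) ^+ 2 / n%:R)) <= C * Num.sqrt n%:R.
Proof.
have a0 : 0 < Num.sqrt al by rewrite sqrtr_gt0.
exists (Num.sqrt pi / Num.sqrt al + 2) => [|n m c n0].
  by rewrite ltr_wpDl// divr_ge0 ?sqrtr_ge0.
have s0 : 0 < Num.sqrt n%:R :> R by rewrite sqrtr_gt0 ltr0n.
have s1 : 1 <= Num.sqrt n%:R :> R.
  by rewrite -[X in X <= _]sqrtr1 ler_wsqrtr// ler1n.
under eq_bigr do rewrite lattice_gaussE//.
have h0 := step_gt0 n0.
have := gauss_sum_le (- (Num.sqrt (al / n%:R) * c)) m h0.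
move=> H; rewrite -(ler_pM2l h0); apply: (le_trans H).
rewrite stepE// (_ : Num.sqrt al / Num.sqrt n%:R * ((Num.sqrt pi / Num.sqrt al + 2) *
  Num.sqrt n%:R) = Num.sqrt pi + 2 * Num.sqrt al); last by field; rewrite !gt_eqF.
by rewrite lerD2l ler_pM2l// ler_pdivrMr// ler_peMr// ltW.
Qed.

(** Unlike the upper bound, the limit needs the centre at distance [X sqrt n] from both ends of the
    range, so that almost all of the mass is summed. *)
Lemma lattice_gauss_lim (e : R) : 0 < e -> exists2 X : R, 0 < X &
  exists n0, forall (n m : nat) (c : R), (n0 <= n)%N ->
  X * Num.sqrt n%:R <= c -> c + X * Num.sqrt n%:R <= m%:R ->
  `|(Num.sqrt n%:R)^-1 * (\sum_(j < m) expR (- (al * (j%:R - c) ^+ 2 / n%:R)))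
    - Num.sqrt (pi / al)| <= e.
Proof.
move=> e0; have a0 : 0 < Num.sqrt al by rewrite sqrtr_gt0.
have e1 : 0 < e * Num.sqrt al / 2 by rewrite divr_gt0// mulr_gt0.
have [X HX] := gauss_sum_lim e1.
exists ((`|X| + 1) / Num.sqrt al); first by rewrite divr_gt0// ltr_wpDl.
(* Beyond [(4 / e)^2] the mesh error [2 h], with [h = sqrt al / sqrt n], is at most half of
   [e sqrt al]. *)
exists (Num.trunc ((4 / e) ^+ 2)).+1 => n m c nn c1 c2.
have n0 : (0 < n)%N by apply: leq_trans nn.
have s0 : 0 < Num.sqrt n%:R :> R by rewrite sqrtr_gt0 ltr0n.
have es : 4 / e <= Num.sqrt n%:R.
  rewrite (le_trans (ler_norm _))// -sqrtr_sqr ler_wsqrtr//.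
  apply: le_trans (ltW (truncnS_gt _)) _; by rewrite ler_nat.
under eq_bigr do rewrite lattice_gaussE//.
have h0 := step_gt0 n0.
have := HX (Num.sqrt (al / n%:R)) (- (Num.sqrt (al / n%:R) * c)) m h0.
set h := Num.sqrt (al / n%:R) in h0 *.
have hE : h = Num.sqrt al / Num.sqrt n%:R by rewrite /h stepE.
have hs : h * Num.sqrt n%:R = Num.sqrt al by rewrite hE divfK// gt_eqF.
have hX : h * ((`|X| + 1) / Num.sqrt al * Num.sqrt n%:R) = `|X| + 1.
  by rewrite -hs; field; rewrite !gt_eqF.
have XX := ler_norm X.
have k1 := ler_wpM2l (ltW h0) c1; have k2 := ler_wpM2l (ltW h0) c2.
rewrite mulrDr hX in k2; rewrite hX in k1.
have p1 : - (h * c) <= - X by lra.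
have p2 : X <= h * m%:R - h * c by lra.
move=> /(_ p1 p2); move: (bigop.body _ _ _) => S.
have -> : (Num.sqrt n%:R)^-1 = h / Num.sqrt al.
  by rewrite hE; field; rewrite !gt_eqF.
have -> : Num.sqrt (pi / al) = Num.sqrt pi / Num.sqrt al.
  by rewrite sqrtrM ?pi_ge0// sqrtrV// ltW.
rewrite (mulrAC h) -mulrBl normrM normfV (gtr0_norm a0) ler_pdivrMr// => H.
apply: (le_trans H).
have : 2 * h <= e * Num.sqrt al / 2.
  rewrite hE mulrA ler_pdivrMr//.
  have := ler_wpM2l (ltW e0) es; rewrite mulrCA divff ?gt_eqF// mulr1 => H4.
  have := ler_wpM2l (ltW a0) H4; lra.
lra.
Qed.

End LatticeGauss.

(** * The constant of the binomial local limit *)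

Section BinomialConstant.
Variable R : realType.

Lemma binp_sum N : \sum_(k < N.+1) binp R N k = 1.
Proof.
rewrite /binp -mulr_suml -natr_sum.
have -> : (\sum_(i < N.+1) 'C(N, i))%:R = 2 ^+ N :> R.
  rewrite -[2%:R]/(1 + 1 : R) exprDn natr_sum.
  by apply: eq_bigr => i _; rewrite !expr1n mulr1.
by rewrite divff// expf_neq0// pnatr_eq0.
Qed.

(** The probabilities [binp N k] add up to 1, while their Gaussian approximations [binp_const / sqrt
    N * exp (- 2 (k - N/2)^2 / N)] add up to nearly [binp_const * sqrt (pi / 2)]. *)
Lemma binp_const_sqr : binp_const R ^+ 2 = 2 / pi.
Proof.
have [C C0 HC] := binp_domination R.
pose q (t : nat * nat) : R := bdev R t.1 t.2 ^+ 2 / t.1%:R.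
pose f (t : nat * nat) : R := Num.sqrt t.1%:R * binp R t.1 t.2.
pose g (t : nat * nat) : R := binp_const R * expR (- (1 / 2 * q t)).
have q0 t : 0 <= q t by rewrite divr_ge0 ?sqr_ge0.
have k0 := binp_const_gt0 R.
have Hf t : `|f t| <= (C + binp_const R) * expR (- (1 / 16 * q t)).
  rewrite ger0_norm ?mulr_ge0 ?sqrtr_ge0 ?binp_ge0//.
  apply: (le_trans (HC t.1 t.2)).
  rewrite invfM [X in - X](_ : _ = 1 / 16 * q t); last by rewrite /q; ring.
  by rewrite ler_wpM2r ?expR_ge0// lerDl ltW.
have Hg t : `|g t| <= (C + binp_const R) * expR (- (1 / 16 * q t)).
  rewrite ger0_norm ?mulr_ge0 ?expR_ge0 ?(ltW k0)//.
  apply: ler_pM; rewrite ?expR_ge0 ?(ltW k0)//; first by rewrite lerDr ltW.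
  by rewrite ler_expR; have := q0 t; lra.
have fg K : (f t - g t) @[t --> unif_oo fst [set t | q t <= K]] --> 0.
  apply: (@ratio_to_diff _ _ _ _ f (fun t => 1 / 2 * q t)).
    by near=> t; rewrite mulr_ge0.
  have -> : (fun t => f t * expR (1 / 2 * q t)) = (fun t : nat * nat =>
     Num.sqrt (t.1%:R : R) * binp R t.1 t.2 * expR (bdev R t.1 t.2 ^+ 2 / (2 * t.1%:R))).
    by apply/funext => t; rewrite /f /q invfM; congr (_ * expR _); ring.
  apply: (@binp_ratio_cvg _ _ _ _ fst snd (Num.sqrt `|K|)); first exact: unif_oo_size.
  exists 1%N => t t1 /= qK.
  rewrite -sqrtrM// -sqrtr_sqr ler_wsqrtr//.
  move: qK; rewrite /q ler_pdivrMr ?ltr0n// => /le_trans; apply.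
  by rewrite ler_wpM2r// ler_norm.
(* Since [q = 4 (k - N/2)^2 / N], the error weight [exp (- q / 32)] has rate 1/8 and the main term
   [exp (- q / 2)] has rate 2. *)
have [C1 C10 H1] := @lattice_gauss_le R (1 / 8) ltac:(lra).
have key e : 0 < e ->
    `|1 - binp_const R * Num.sqrt (pi / 2)| <= e * (C1 + binp_const R).
  move=> e0.
  have [n1 Hn1] := dominated_patch (addr_gt0 C0 k0) (ltac:(lra) : 0 < 1 / 16 :> R)
    q0 Hf Hg fg e0.
  have [X X0 [n2 Hn2]] := @lattice_gauss_lim R 2 ltac:(lra) e e0.
  pose n := (maxn (maxn n1 n2) (Num.trunc ((2 * X) ^+ 2))).+1.
  have nn1 : (n1 <= n)%N by rewrite /n; lia.
  have nn2 : (n2 <= n)%N by rewrite /n; lia.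
  have n0 : (0 < n)%N by [].
  have s0 : 0 < Num.sqrt n%:R :> R by rewrite sqrtr_gt0 ltr0n.
  have Xs : 2 * X <= Num.sqrt n%:R.
    rewrite (le_trans (ler_norm _))// -sqrtr_sqr ler_wsqrtr//.
    apply: le_trans (ltW (truncnS_gt _)) _; by rewrite ler_nat /n ltnS leq_maxr.
  have Xn : X * Num.sqrt n%:R <= n%:R / 2.
    rewrite -[X in _ <= X / 2]sqr_sqrtr ?ler0n// expr2.
    by have := ler_wpM2r (ltW s0) Xs; lra.
  clearbody n; have nS : n%:R / 2 + X * Num.sqrt n%:R <= n.+1%:R by rewrite -[n.+1%:R]natr1; lra.
  have L := Hn2 n n.+1 (n%:R / 2) nn2 Xn nS.
  set S1 := \sum_(j < n.+1) _ in L.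
  have sumf : \sum_(k < n.+1) f (n, k : nat) = Num.sqrt n%:R.
    by rewrite /f /= -mulr_sumr binp_sum mulr1.
  have sumg : \sum_(k < n.+1) g (n, k : nat) = binp_const R * S1.
    rewrite /g -mulr_sumr; congr (_ * _); apply: eq_bigr => j _; congr expR.
    by rewrite /q /bdev /=; field; rewrite pnatr_eq0 -lt0n.
  have D : `|Num.sqrt n%:R - binp_const R * S1| <= e * (C1 * Num.sqrt n%:R).
    rewrite -{1}sumf -sumg -sumrB; apply: le_trans (ler_norm_sum _ _ _) _.
    apply: (@le_trans _ _ (\sum_(k < n.+1) e * expR (- (1 / 16 / 2 * q (n, k : nat))))).
      by apply: ler_sum => k _; exact: Hn1.
    rewrite -mulr_sumr ler_pM2l//; apply: le_trans (H1 n n.+1 (n%:R / 2) n0).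
    rewrite le_eqVlt; apply/orP; left; apply/eqP; apply: eq_bigr => j _; congr expR.
    by rewrite /q /bdev /=; field; rewrite pnatr_eq0 -lt0n.
  have D' : `|1 - binp_const R * ((Num.sqrt n%:R)^-1 * S1)| <= e * C1.
    rewrite -(ler_pM2r s0) -{2}(gtr0_norm s0) -normrM mulrBl mul1r.
    rewrite (_ : _ * ((Num.sqrt n%:R)^-1 * S1) * _ = binp_const R * S1) -?mulrA//.
    by field; rewrite gt_eqF.
  set P := Num.sqrt (pi / 2) in L *; set Q := _ * S1 in L D'.
  have -> : 1 - binp_const R * P = (1 - binp_const R * Q) + binp_const R * (Q - P) by ring.
  apply: le_trans (ler_normD _ _) _; rewrite [X in _ <= X]mulrDr; apply: lerD => //.
  by rewrite normrM (gtr0_norm k0) mulrC ler_wpM2r// ltW.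
have : 1 - binp_const R * Num.sqrt (pi / 2) = 0.
  apply/eqP; rewrite -normr_eq0; apply/eqP/le_anti; rewrite normr_ge0 andbT.
  apply/ler_addgt0Pl => e e0; rewrite addr0.
  have D0 : 0 < C1 + binp_const R by rewrite addr_gt0.
  by have := key (e / (C1 + binp_const R)) (divr_gt0 e0 D0); rewrite divfK// gt_eqF.
move/eqP; rewrite subr_eq0 => /eqP/esym H.
have p0 : 0 < Num.sqrt (pi / 2) :> R by rewrite sqrtr_gt0 divr_gt0// pi_gt0.
have -> : binp_const R = (Num.sqrt (pi / 2))^-1.
  by rewrite -[LHS](mulfK (lt0r_neq0 p0)) H mul1r.
by rewrite exprVn sqr_sqrtr ?divr_ge0 ?pi_ge0// invf_div.
Unshelve. all: by end_near. Qed.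

End BinomialConstant.

(** * The term of the sum over [j] as a product of probabilities, and its domination *)

Section ChainTerm.
Variables (R : realType) (d : nat).
Implicit Types (n : nat) (f : nat -> nat).

Definition chain_rest n f := (n - \sum_(k < d) f k)%N.

(** Stated for any sequence [f] in place of [chain s j]: uniformity in [s] and [j] becomes
    uniformity in [f]. *)
Definition chain_term n f : R :=
  if (\sum_(k < d) f k <= n)%N
  then (\prod_(k < d) binp R (f k) (f k.+1)) *
       ((bin_last (chain_rest n f) (f d))%:R / 2 ^+ chain_rest n f)
  else 0.

Lemma comp_count_chain_term n (s : multinom d) j :
  (comp_count n s j)%:R / 2 ^+ n = chain_term n (chain s j).
Proof.
rewrite /comp_count /chain_term /chain_rest chain_end; case: ifP => H; last by rewrite mul0r.
rewrite natrM /bin_prod natr_prod /binp prodf_div mulrACA -invfM; congr (_ * _^-1).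
have -> : \prod_(k < d) (2 : R) ^+ chain s j k = 2 ^+ (\sum_(k < d) chain s j k).
  by rewrite (big_morph _ (exprD 2) (expr0 _)).
by rewrite -exprD subnKC.
Qed.

Definition chain_dev n f k : R := (f k)%:R - n%:R / 2 ^+ k.+1.

Lemma chain_dev_eps n f k :
  chain_dev n f k - 2 * chain_dev n f k.+1 = bdev R (f k) (f k.+1).
Proof.
rewrite /chain_dev /bdev (exprS _ k.+1); have : (2 : R) ^+ k.+1 != 0.
  by rewrite expf_neq0// pnatr_eq0.
by move: (2 ^+ k.+1) => y y0; field.
Qed.

Lemma chain_dev_sum n f :
  \sum_(k < d) chain_dev n f k = (\sum_(k < d) f k)%:R - n%:R + n%:R / 2 ^+ d.
Proof.
rewrite natr_sum /chain_dev sumrB.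
suff -> : \sum_(k < d) n%:R / 2 ^+ k.+1 = n%:R - n%:R / 2 ^+ d :> R by ring.
elim: (d) => [|m IH]; first by rewrite big_ord0 expr0 divr1 subrr.
rewrite big_ord_recr /= IH exprS; have : (2 : R) ^+ m != 0.
  by rewrite expf_neq0// pnatr_eq0.
by move: (2 ^+ m) => y y0; field.
Qed.

Lemma chain_restE n f : (\sum_(k < d) f k <= n)%N ->
  (chain_rest n f)%:R = n%:R / 2 ^+ d - \sum_(k < d) chain_dev n f k.
Proof. by move=> H; rewrite /chain_rest natrB// chain_dev_sum; ring. Qed.

Lemma chain_dev_eta n f : (\sum_(k < d) f k <= n)%N ->
  2 * chain_dev n f d + \sum_(k < d) chain_dev n f k = - bdev R (chain_rest n f) (f d).
Proof.
move=> H; rewrite /bdev chain_restE// {1}/chain_dev exprS.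
have : (2 : R) ^+ d != 0 by rewrite expf_neq0// pnatr_eq0.
by move: (2 ^+ d) (\sum_(k < d) _) => y S y0; field.
Qed.

Definition chain_sqr n f : R := chain_form d (chain_dev n f) (chain_dev n f).

Lemma chain_sqrE n f : (\sum_(k < d) f k <= n)%N ->
  chain_sqr n f = \sum_(k < d) 2 ^+ k.+1 * bdev R (f k) (f k.+1) ^+ 2 +
    2 ^+ d * bdev R (chain_rest n f) (f d) ^+ 2.
Proof.
move=> H; rewrite /chain_sqr /chain_form chain_dev_eta//.
rewrite mulrN mulrN mulNr opprK.
by congr (_ + _); [apply: eq_bigr => k _; rewrite chain_dev_eps|]; rewrite -mulrA -expr2.
Qed.

Lemma chain_sqr_ge0 n f : 0 <= chain_sqr n f. Proof. exact: chain_form_ge0. Qed.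

Lemma chain_sqr_le n f : (\sum_(k < d) f k <= n)%N ->
  chain_sqr n f <= 2 ^+ d * (\sum_(k < d) bdev R (f k) (f k.+1) ^+ 2 +
    bdev R (chain_rest n f) (f d) ^+ 2).
Proof.
move=> H; rewrite chain_sqrE// mulrDr lerD2r mulr_sumr ler_sum// => k _.
by rewrite ler_wpM2r ?sqr_ge0// ler_weXn2l ?ler1n.
Qed.

Lemma bin_last_le M j : (bin_last M j)%:R / 2 ^+ M <= binp R M j.
Proof.
rewrite /binp ler_wpM2r ?invr_ge0 ?exprn_ge0// ler_nat.
by case: M j => [|M] [|j] //=; rewrite binS leq_addl.
Qed.

(** Reduces the last factor to a symmetric binomial; [j / M] tends to 1/2, the extra 1/2 in
    [chain_const]. *)
Lemma bin_last_ratio M j : (0 < M)%N ->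
  (bin_last M j)%:R / 2 ^+ M = binp R M j * (j%:R / M%:R).
Proof.
case: M j => [|M] [|j] //= _; first by rewrite !mul0r mulr0.
rewrite /binp mulrAC; congr (_ / _).
apply: (@mulfI _ M.+1%:R); first by rewrite pnatr_eq0.
by rewrite mulrCA [X in _ = _ * X]mulrCA mulfV ?pnatr_eq0// mulr1 -!natrM mul_bin_diag mulnC.
Qed.

Lemma chain_term_ge0 n f : 0 <= chain_term n f.
Proof.
rewrite /chain_term; case: ifP => // _; rewrite mulr_ge0 ?divr_ge0 ?exprn_ge0//.
by apply: prodr_ge0 => k _; exact: binp_ge0.
Qed.

Lemma sqr_quot_le (x c : R) (N n : nat) : 0 < c -> (0 < N)%N -> (N <= n)%N ->
  x ^+ 2 / (c * n%:R) <= x ^+ 2 / (c * N%:R).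
Proof.
move=> c0 N0 Nn; have n0 := leq_trans N0 Nn.
rewrite ler_wpM2l ?sqr_ge0// lef_pV2 ?posrE; last 2 first.
- by rewrite mulr_gt0// ltr0n.
- by rewrite mulr_gt0// ltr0n.
by rewrite ler_pM2l// ler_nat.
Qed.

Lemma binp_chernoff_le N k n : (N <= n)%N ->
  binp R N k <= expR (- (bdev R N k ^+ 2 / (8 * n%:R))).
Proof.
case: (posnP N) => [->|N0] Nn.
  case: k => [|k]; last by rewrite /binp bin0n mul0r expR_ge0.
  by rewrite /binp /bdev bin0 expr0 divr1 mulr0 subrr expr0n mul0r oppr0 expR0.
apply: le_trans (binp_chernoff R N k) _; rewrite ler_expR lerN2.
exact: sqr_quot_le.
Qed.

Lemma chain_le n f k : (\sum_(k < d) f k <= n)%N -> (k < d)%N -> (f k <= n)%N.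
Proof.
move=> H kd; apply: leq_trans H; rewrite (bigD1 (Ordinal kd))//=.
exact: leq_addr.
Qed.

Lemma chain_term_chernoff n f :
  chain_term n f <= expR (- (chain_sqr n f / (8 * 2 ^+ d * n%:R))).
Proof.
rewrite /chain_term; case: ifP => H; last exact: expR_ge0.
apply: (@le_trans _ _ (expR (- ((\sum_(k < d) bdev R (f k) (f k.+1) ^+ 2 +
    bdev R (chain_rest n f) (f d) ^+ 2) / (8 * n%:R))))); last first.
  rewrite ler_expR lerN2 -mulrA mulrCA invfM mulrA ler_wpM2r//.
  by rewrite ler_pdivrMr ?exprn_gt0// mulrC chain_sqr_le.
rewrite mulrDl opprD expRD mulr_suml -sumrN expR_sum; apply: ler_pM.
- by apply: prodr_ge0 => k _; exact: binp_ge0.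
- by rewrite divr_ge0 ?exprn_ge0.
- by apply: ler_prod => k _; rewrite binp_ge0 binp_chernoff_le// (chain_le H).
- apply: le_trans (bin_last_le _ _) _; apply: binp_chernoff_le.
  exact: leq_subr.
Qed.

(** Trades [sqrt N] for [sqrt n] when [N] is at least a fixed fraction of [n]. *)
Lemma binp_central (C0 : R) : 0 < C0 -> (forall N k,
    Num.sqrt N%:R * binp R N k <= C0 * expR (- (bdev R N k ^+ 2 / (16 * N%:R)))) ->
  forall (A : R) (n N k : nat), 1 <= A -> (0 < N <= n)%N -> n%:R <= A * N%:R ->
  Num.sqrt n%:R * binp R N k <= A * C0 * expR (- (bdev R N k ^+ 2 / (16 * n%:R))).
Proof.
move=> C00 HC A n N k A1 /andP[N0 Nn] nA.
apply: (@le_trans _ _ (A * (Num.sqrt N%:R * binp R N k))).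
  rewrite [X in _ <= X]mulrA ler_wpM2r ?binp_ge0//.
  apply: (@le_trans _ _ (Num.sqrt (A ^+ 2 * N%:R))).
    rewrite ler_wsqrtr// (le_trans nA)// ler_wpM2r//.
    by rewrite expr2 ler_peMl// (le_trans ler01).
  by rewrite sqrtrM ?sqr_ge0// sqrtr_sqr ger0_norm// (le_trans ler01).
rewrite -mulrA ler_pM2l ?(lt_le_trans ltr01)//.
apply: (le_trans (HC N k)); rewrite ler_pM2l// ler_expR lerN2.
exact: sqr_quot_le.
Qed.

Lemma pow_exp_bound (m : nat) (c : R) : 0 < c ->
  exists2 C : R, 0 < C & forall n, n%:R ^+ m.+1 * expR (- (c * n%:R)) <= C.
Proof.
move=> c0; exists (m.+1`!%:R / c ^+ m.+1).
  by rewrite divr_gt0 ?exprn_gt0// ltr0n fact_gt0.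
move=> n; have y0 : 0 <= c * n%:R by rewrite mulr_ge0// ltW.
have := @expR_ge1Dxn _ _ m y0; rewrite exprMn => H.
rewrite expRN ler_pdivrMr ?expR_gt0// mulrAC ler_pdivlMr ?exprn_gt0//.
have F0 : 0 < m.+1`!%:R :> R by rewrite ltr0n fact_gt0.
rewrite -ler_pdivrMl// mulrC [n%:R ^+ _ * _]mulrC; apply: le_trans H.
by rewrite lerDr.
Qed.

(** If the form is at most [(ga n)^2], every [N_k] with [k < d] and [M] are of order [n] and each of
    the [d + 1] factors contributes [1 / sqrt n]. Otherwise the Chernoff bound is exponentially
    small in [n]. *)
Lemma chain_term_domination : exists2 C : R, 0 < C & forall n f,
  Num.sqrt n%:R ^+ d.+1 * chain_term n f <=
  C * expR (- ((16 * 2 ^+ d)^-1 * (chain_sqr n f / n%:R))).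
Proof.
have [C0 C00 HC] := binp_domination R.
pose M0 : R := d.+2%:R * 4 ^+ d.
have M00 : 0 < M0 by rewrite mulr_gt0 ?exprn_gt0.
(* Coercivity then bounds each deviation by [n / (2^(d+2) (d+1))]. Even the sum of [d] deviations is
   at most [n / 2^(d+2)], which leaves [f k] for [k < d] and [chain_rest n f] at least that
   large. *)
pose ga : R := (2 ^+ d.+2 * d.+1%:R * M0)^-1.
have ga0 : 0 < ga by rewrite invr_gt0 mulr_gt0// mulr_gt0 ?exprn_gt0// ltr0n.
have dd0 : 0 < 16 * 2 ^+ d :> R by rewrite mulr_gt0 ?exprn_gt0.
have gp : 0 < (16 * 2 ^+ d)^-1 * ga ^+ 2.
  by apply: mulr_gt0; rewrite ?invr_gt0// exprn_gt0.
have [C1 C10 H1] := pow_exp_bound d gp.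
exists ((2 ^+ d.+2 * C0) ^+ d.+1 + C1) => [|n f].
  by rewrite addr_gt0// exprn_gt0// mulr_gt0// exprn_gt0.
have CC : 0 < (2 ^+ d.+2 * C0) ^+ d.+1 by rewrite exprn_gt0// mulr_gt0// exprn_gt0.
case: (posnP n) => [->|n0].
  by rewrite sqrtr0 expr0n mul0r mulr_ge0 ?expR_ge0// addr_ge0 ?ltW.
have np : 0 < n%:R :> R by rewrite ltr0n.
have [small|big] := leP (chain_sqr n f) ((ga * n%:R) ^+ 2); last first.
  apply: (@le_trans _ _ (C1 * expR (- ((16 * 2 ^+ d)^-1 * (chain_sqr n f / n%:R))))); last first.
    by rewrite ler_wpM2r ?expR_ge0// lerDr ltW.
  (* Half of the Chernoff exponent absorbs the power of [n]; the other half is the claimed decay. *)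
  apply: (@le_trans _ _ (n%:R ^+ d.+1 * (expR (- ((16 * 2 ^+ d)^-1 * (chain_sqr n f / n%:R)))
      * expR (- ((16 * 2 ^+ d)^-1 * (chain_sqr n f / n%:R)))))).
    apply: ler_pM; rewrite ?exprn_ge0 ?sqrtr_ge0 ?chain_term_ge0//.
      rewrite lerXn2r ?nnegrE ?sqrtr_ge0//.
      rewrite -[X in _ <= X]sqr_sqrtr ?ler0n// expr2 ler_peMl ?sqrtr_ge0//.
      by rewrite -[X in X <= _]sqrtr1 ler_wsqrtr// ler1n.
    apply: le_trans (chain_term_chernoff n f) _; rewrite -expRD ler_expR.
    rewrite le_eqVlt; apply/orP; left; apply/eqP; field.
    by rewrite !gt_eqF// exprn_gt0.
  rewrite mulrA ler_wpM2r ?expR_ge0//; apply: le_trans (H1 n).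
  rewrite ler_wpM2l ?exprn_ge0// ler_expR lerN2 -mulrA ler_pM2l ?invr_gt0//.
  by rewrite ler_pdivlMr// -mulrA -expr2 -exprMn ltW.
apply: (@le_trans _ _ ((2 ^+ d.+2 * C0) ^+ d.+1 *
    expR (- ((16 * 2 ^+ d)^-1 * (chain_sqr n f / n%:R))))); last first.
  by rewrite ler_wpM2r ?expR_ge0// lerDl ltW.
rewrite {1}/chain_term; case: ifP => H; last first.
  by rewrite mulr0 mulr_ge0 ?expR_ge0// ltW.
have gan : 0 <= ga * n%:R by rewrite mulr_ge0// ltW.
have dev := chain_form_coercive gan small.
have Mga : M0 * (ga * n%:R) = n%:R / (2 ^+ d.+2 * d.+1%:R).
  by rewrite /ga; field; rewrite !gt_eqF// exprn_gt0.
rewrite -/M0 Mga in dev.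
have p2 k : 0 < (2 : R) ^+ k by rewrite exprn_gt0.
have devd : n%:R / (2 ^+ d.+2 * d.+1%:R) <= n%:R / 2 ^+ d.+2 :> R.
  have q1 : (2 : R) ^+ d.+2 <= 2 ^+ d.+2 * d.+1%:R.
    by rewrite ler_peMr ?(ltW (p2 _))// ler1n.
  by rewrite ler_pM2l// lef_pV2// posrE// mulr_gt0// ltr0n.
have half k : (k <= d)%N -> n%:R / 2 ^+ d.+1 <= n%:R / 2 ^+ k.+1 :> R.
  by move=> kd; rewrite ler_pM2l// lef_pV2 ?posrE// ler_weXn2l ?ler1n.
have two : n%:R / 2 ^+ d.+1 = 2 * (n%:R / 2 ^+ d.+2) :> R.
  by rewrite (exprS _ d.+1); field; rewrite gt_eqF.
have fk k : (k < d)%N -> n%:R <= 2 ^+ d.+2 * (f k)%:R :> R.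
  move=> kd; rewrite -ler_pdivrMl// mulrC.
  have := dev k (ltnW kd); rewrite ler_norml /chain_dev => /andP[h _].
  move: h devd (half k (ltnW kd)); rewrite two.
  move: (n%:R / (2 ^+ d.+2 * _)) (n%:R / 2 ^+ d.+2) (n%:R / 2 ^+ k.+1) => a b c.
  by move=> *; lra.
have fM : n%:R <= 2 ^+ d.+2 * (chain_rest n f)%:R :> R.
  rewrite -ler_pdivrMl// mulrC chain_restE//.
  have : `|\sum_(k < d) chain_dev n f k| <= n%:R / 2 ^+ d.+2.
    apply: le_trans (ler_norm_sum _ _ _) _.
    apply: (@le_trans _ _ (\sum_(k < d) n%:R / (2 ^+ d.+2 * d.+1%:R))).
      by apply: ler_sum => k _; rewrite dev// ltnW.
    rewrite sumr_const card_ord -[X in X <= _]mulr_natr.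
    have -> : n%:R / (2 ^+ d.+2 * d.+1%:R) * d%:R = n%:R / 2 ^+ d.+2 * (d%:R / d.+1%:R) :> R.
      by rewrite invfM; ring.
    rewrite ler_piMr//.
    by rewrite ler_pdivrMr ?ltr0n// mul1r ler_nat.
  rewrite ler_norml => /andP[_ h].
  have : n%:R / 2 ^+ d = 4 * (n%:R / 2 ^+ d.+2) :> R.
    by rewrite !exprS; field; rewrite gt_eqF.
  have : 0 <= n%:R / 2 ^+ d.+2 :> R by rewrite divr_ge0// ltW.
  move: h; move: (n%:R / 2 ^+ d.+2) (n%:R / 2 ^+ d) (\sum_(k < d) _) => a b c.
  by move=> *; lra.
have pos N : n%:R <= 2 ^+ d.+2 * N%:R :> R -> (0 < N)%N.
  by case: N => //; rewrite mulr0 => /(lt_le_trans np); rewrite ltxx.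
have A1 : 1 <= (2 : R) ^+ d.+2 by rewrite exprn_ege1// ler1n.
have cen N k := binp_central C00 HC (n := n) (N := N) k A1.
apply: (@le_trans _ _ ((2 ^+ d.+2 * C0) ^+ d.+1 *
  expR (- ((\sum_(k < d) bdev R (f k) (f k.+1) ^+ 2 +
    bdev R (chain_rest n f) (f d) ^+ 2) / (16 * n%:R))))); last first.
  have -> : (16 * 2 ^+ d)^-1 * (chain_sqr n f / n%:R) =
    chain_sqr n f / 2 ^+ d / (16 * n%:R) by rewrite !invfM; ring.
  rewrite ler_pM2l// ler_expR lerN2 ler_wpM2r ?invr_ge0 ?mulr_ge0//.
  by rewrite ler_pdivrMr// mulrC chain_sqr_le.
set B := 2 ^+ d.+2 * C0 in CC cen *; clearbody B.
rewrite mulrDl opprD expRD mulr_suml -sumrN expR_sum (exprSr B) (exprSr (Num.sqrt _)).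
rewrite mulrACA [X in _ <= X]mulrACA.
have e1 (c : R) : c ^+ d = \prod_(k < d) c by rewrite prodr_const card_ord.
rewrite (e1 B) (e1 (Num.sqrt _)) -!big_split /=; apply: ler_pM.
- by apply: prodr_ge0 => k _; rewrite mulr_ge0 ?sqrtr_ge0 ?binp_ge0.
- by rewrite mulr_ge0 ?sqrtr_ge0// divr_ge0// exprn_ge0.
- apply: ler_prod => k _; rewrite mulr_ge0 ?sqrtr_ge0 ?binp_ge0//=.
  by apply: cen; rewrite ?fk// pos ?fk// (chain_le H).
- apply: le_trans (cen _ _ _ fM); first by rewrite ler_wpM2l ?sqrtr_ge0// bin_last_le.
  by rewrite pos//= leq_subr.
Qed.

End ChainTerm.

(** * The local limit of a single term *)

Section Limits.
Variable R : realType.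

Lemma cvg_prod T (F : set_system T) (FF : Filter F) m (phi : nat -> T -> R) (l : nat -> R) :
  (forall k, (k < m)%N -> phi k t @[t --> F] --> l k) ->
  \prod_(k < m) phi k t @[t --> F] --> \prod_(k < m) l k.
Proof.
elim: m => [|m IH] H.
  under eq_fun do rewrite big_ord0.
  by rewrite big_ord0; exact: cvg_cst.
under eq_fun do rewrite big_ord_recr /=.
rewrite big_ord_recr /=; apply: cvgM; last exact: H.
by apply: IH => k km; apply: H; rewrite ltnS ltnW.
Qed.

Lemma cvg_near_eq T (F : set_system T) (FF : Filter F) (f g : T -> R) (l : R) :
  (\forall t \near F, f t = g t) -> f t @[t --> F] --> l -> g t @[t --> F] --> l.
Proof. by move=> fg; apply: cvg_trans; exact: near_eq_cvg. Qed.

Lemma cvg_bounded0 T (F : set_system T) (FF : Filter F) (f g : T -> R) (B : R) :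
  (\forall t \near F, `|f t| <= B) -> g t @[t --> F] --> (0 : R) ->
  f t * g t @[t --> F] --> (0 : R).
Proof.
move=> fB g0; apply: (@squeeze_cvgr _ _ _ _ (fun t => - (`|B| * `|g t|)) (fun t => `|B| * `|g t|)).
- near=> t; rewrite -ler_norml normrM ler_wpM2r//.
  by apply: le_trans (ler_norm B); near: t.
- rewrite -oppr0 -(mulr0 `|B|); apply: cvgN; apply: cvgM; first exact: cvg_cst.
  by rewrite -(@normr0 _ R); exact: cvg_norm.
- rewrite -(mulr0 `|B|); apply: cvgM; first exact: cvg_cst.
  by rewrite -(@normr0 _ R); exact: cvg_norm.
Unshelve. all: by end_near. Qed.

Lemma cvg_expR T (F : set_system T) (FF : Filter F) (f : T -> R) (l : R) :
  f t @[t --> F] --> l -> expR (f t) @[t --> F] --> expR l.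
Proof.
by move=> fl; apply: (@cvg_comp _ _ _ f expR F (nbhs l) _ fl); exact: continuous_expR.
Qed.

(** Rescales the local limit from [N] to [n] when [N / n] tends to [1 / A]. The exponent changes by
    [bdev^2 / (2 n)], which is bounded, times [A - n / N], which tends to 0. *)
Lemma binp_scaled_cvg T (F : set_system T) (FF : Filter F) (n N k : T -> nat) (A K : R) :
  0 < A -> n @ F --> \oo ->
  (N t)%:R / (n t)%:R @[t --> F] --> A^-1 ->
  (\forall t \near F, bdev R (N t) (k t) ^+ 2 <= K * (n t)%:R) ->
  Num.sqrt (n t)%:R * binp R (N t) (k t) *
    expR (A * bdev R (N t) (k t) ^+ 2 / (2 * (n t)%:R)) @[t --> F]
  --> Num.sqrt A * binp_const R.
Proof.
move=> A0 noo Nn dK.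
have npos : \forall t \near F, (0 < n t)%N by move/cvgnyPge : noo => /(_ 1%N).
have Ninv : (n t)%:R / (N t)%:R @[t --> F] --> A.
  apply: (@cvg_near_eq _ _ _ (fun t => ((N t)%:R / (n t)%:R)^-1)).
    by near=> t; rewrite invf_div.
  by rewrite -[A]invrK; apply: cvgV => //; rewrite invr_neq0// gt_eqF.
have half : \forall t \near F, (n t)%:R <= 2 * A * (N t)%:R :> R.
  have A2 : (2 * A)^-1 < A^-1 by rewrite ltf_pV2 ?posrE ?mulr_gt0//; lra.
  have H : \forall t \near F, (2 * A)^-1 <= (N t)%:R / (n t)%:R by apply: (cvgr_ge _ Nn).
  near=> t; have nt : (0 < n t)%N by near: t.
  have : (2 * A)^-1 <= (N t)%:R / (n t)%:R by near: t.
  by rewrite ler_pdivlMr ?ltr0n// ler_pdivrMl// mulr_gt0.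
have Noo : N @ F --> \oo.
  apply/cvgnyPge => m; move/cvgnyPge : noo => /(_ (Num.trunc (2 * A * m%:R)).+1).
  apply: filterS2 half => t h tm; rewrite -(ler_nat R).
  have A2 : 0 < 2 * A by rewrite mulr_gt0.
  rewrite -(ler_pM2l A2); apply: le_trans h.
  by apply: le_trans (ltW (truncnS_gt _)) _; rewrite ler_nat.
have Npos : \forall t \near F, (0 < N t)%N by move/cvgnyPge : Noo => /(_ 1%N).
have dK' : \forall t \near F, `|bdev R (N t) (k t)| <=
    Num.sqrt (`|K| * (2 * A)) * Num.sqrt ((N t)%:R : R).
  near=> t; rewrite -sqrtrM ?mulr_ge0 ?(ltW A0)// -sqrtr_sqr ler_wsqrtr//.
  have h1 : bdev R (N t) (k t) ^+ 2 <= K * (n t)%:R by near: t.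
  have h2 : (n t)%:R <= 2 * A * (N t)%:R :> R by near: t.
  apply: (le_trans h1); apply: (@le_trans _ _ (`|K| * (n t)%:R)).
    by rewrite ler_wpM2r// ler_norm.
  by rewrite -mulrA ler_wpM2l.
have R1 := binp_ratio_cvg FF Noo dK'.
have R2 : Num.sqrt ((n t)%:R / (N t)%:R : R) @[t --> F] --> Num.sqrt A.
  by apply: (@cvg_comp _ _ _ _ Num.sqrt F (nbhs A) _ Ninv); exact: sqrt_continuous.
have R3 : expR (bdev R (N t) (k t) ^+ 2 / (2 * (n t)%:R) * (A - (n t)%:R / (N t)%:R))
    @[t --> F] --> (1 : R).
  rewrite -[X in _ --> X](@expR0 R); apply: cvg_expR.
  apply: (@cvg_bounded0 _ _ _ _ _ `|K|).
    near=> t; have h1 : bdev R (N t) (k t) ^+ 2 <= K * (n t)%:R by near: t.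
    have n0 : 0 < (n t)%:R :> R by rewrite ltr0n; near: t.
    rewrite ger0_norm ?divr_ge0 ?sqr_ge0// ler_pdivrMr ?mulr_gt0//.
    apply: (le_trans h1); apply: (@le_trans _ _ (`|K| * (n t)%:R)).
      by rewrite ler_wpM2r// ler_norm.
    by rewrite ler_wpM2l// ler_peMl// ltW// ltr1n.
  by rewrite -(subrr A); apply: cvgB => //; exact: cvg_cst.
rewrite -[X in _ --> X]mulr1.
apply: cvg_near_eq (cvgM (cvgM R2 R1) R3); near=> t.
have n0 : 0 < (n t)%:R :> R by rewrite ltr0n; near: t.
have N0 : 0 < (N t)%:R :> R by rewrite ltr0n; near: t.
have e1 : Num.sqrt (n t)%:R = Num.sqrt ((n t)%:R / (N t)%:R) * Num.sqrt (N t)%:R :> R.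
  by rewrite -sqrtrM ?divr_ge0// divfK// gt_eqF.
have e2 : expR (A * bdev R (N t) (k t) ^+ 2 / (2 * (n t)%:R)) =
    expR (bdev R (N t) (k t) ^+ 2 / (2 * (N t)%:R)) *
    expR (bdev R (N t) (k t) ^+ 2 / (2 * (n t)%:R) * (A - (n t)%:R / (N t)%:R)).
  by rewrite -expRD; congr expR; field; rewrite !gt_eqF.
by rewrite /= [in RHS]e1 e2; ring.
Unshelve. all: by end_near. Qed.

Lemma sqrt_ratio_cvg0 T (F : set_system T) (FF : Filter F) (n : T -> nat) (f : T -> R) (B : R) :
  n @ F --> \oo -> (\forall t \near F, `|f t| <= B * Num.sqrt (n t)%:R) ->
  f t / (n t)%:R @[t --> F] --> (0 : R).
Proof.
move=> noo fB.
have npos : \forall t \near F, (0 < n t)%N by move/cvgnyPge : noo => /(_ 1%N).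
have y0 : (Num.sqrt ((n t)%:R : R))^-1 @[t --> F] --> (0 : R).
  apply/gtr0_cvgV0; first by apply: filterS npos => t nt; rewrite sqrtr_gt0 ltr0n.
  apply/cvgryPge => A; move/cvgnyPge : noo => /(_ (Num.trunc (A ^+ 2)).+1).
  apply: filterS => t At; rewrite (le_trans (ler_norm _))// -sqrtr_sqr ler_wsqrtr//.
  by apply: le_trans (ltW (truncnS_gt _)) _; rewrite ler_nat.
have H : f t / Num.sqrt ((n t)%:R : R) * (Num.sqrt ((n t)%:R : R))^-1 @[t --> F] --> (0 : R).
  apply: (@cvg_bounded0 _ _ _ _ _ B) => //; near=> t.
  have s0 : 0 < Num.sqrt ((n t)%:R : R) by rewrite sqrtr_gt0 ltr0n; near: t.
  by rewrite normrM normfV (gtr0_norm s0) ler_pdivrMr//; near: t.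
apply: cvg_near_eq H; near=> t.
by rewrite -mulrA -invfM -expr2 sqr_sqrtr// ler0n.
Unshelve. all: by end_near. Qed.

Variable d : nat.

Definition chain_const : R :=
  \prod_(k < d) (Num.sqrt (2 ^+ k.+1) * binp_const R) *
  (Num.sqrt (2 ^+ d) * binp_const R * (1 / 2)).

Definition chain_energy (t : nat * (nat -> nat)) : R := chain_sqr R d t.1 t.2 / t.1%:R.

Lemma chain_energy_ge0 t : 0 <= chain_energy t.
Proof. by rewrite divr_ge0 ?chain_sqr_ge0. Qed.

(** Bounded energy makes all deviations [O(sqrt n)] by coercivity, so [N_k / n] and [M / n] converge
    and every factor has its own local limit; the exponents add up to half the energy. *)
Lemma chain_term_cvg (K : R) :
  Num.sqrt t.1%:R ^+ d.+1 * chain_term R d t.1 t.2 * expR (1 / 2 * chain_energy t)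
    @[t --> unif_oo (T := nat * (nat -> nat)) fst [set t | chain_energy t <= K]]
  --> chain_const.
Proof.
set F := unif_oo _ _.
have FF : Filter F by exact: unif_oo_filter.
have noo : fst @ F --> \oo by exact: unif_oo_size.
have npos : \forall t \near F, (0 < t.1)%N by move/cvgnyPge : noo => /(_ 1%N).
have sK : \forall t \near F, chain_sqr R d t.1 t.2 <= K * t.1%:R.
  have := @unif_oo_in _ (fst : nat * (nat -> nat) -> nat) [set t | chain_energy t <= K].
  apply: filterS2 npos => t t0 /=.
  by rewrite /chain_energy ler_pdivrMr ?ltr0n.
pose M0 : R := d.+2%:R * 4 ^+ d.
have devb k : (k <= d)%N -> \forall t \near F,
    `|chain_dev R t.1 t.2 k| <= M0 * Num.sqrt `|K| * Num.sqrt t.1%:R.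
  move=> kd; apply: filterS sK => t tK.
  rewrite -mulrA; apply: (chain_form_coercive _ _ kd).
    by rewrite mulr_ge0 ?sqrtr_ge0.
  rewrite exprMn !sqr_sqrtr ?ler0n ?normr_ge0//; apply: (le_trans tK).
  by rewrite ler_wpM2r// ler_norm.
have dev0 k : (k <= d)%N -> chain_dev R t.1 t.2 k / t.1%:R @[t --> F] --> (0 : R).
  by move=> kd; apply: sqrt_ratio_cvg0 noo (devb k kd).
have fc k : (k <= d)%N -> (t.2 k)%:R / t.1%:R @[t --> F] --> ((2 : R) ^+ k.+1)^-1.
  move=> kd; apply: (@cvg_near_eq _ _ _
    (fun t => chain_dev R t.1 t.2 k / t.1%:R + ((2 : R) ^+ k.+1)^-1)); last first.
    rewrite -[X in _ --> X]add0r.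
    by apply: cvgD; [exact: dev0|exact: cvg_cst].
  near=> t.
  have n0 : 0 < t.1%:R :> R by rewrite ltr0n; near: t.
  rewrite /chain_dev /=; have : (2 : R) ^+ k.+1 != 0 by rewrite expf_neq0// pnatr_eq0.
  by move: (2 ^+ k.+1) => y y0; field; rewrite y0 gt_eqF.
have sumdev : (\sum_(k < d) chain_dev R t.1 t.2 k) / t.1%:R @[t --> F] --> (0 : R).
  apply: (@sqrt_ratio_cvg0 _ _ _ _ _ (d%:R * (M0 * Num.sqrt `|K|))) noo _.
  apply: filterS sK => t tK; apply: le_trans (ler_norm_sum _ _ _) _.
  apply: (@le_trans _ _ (\sum_(k < d) M0 * Num.sqrt `|K| * Num.sqrt t.1%:R)).
    apply: ler_sum => k _; rewrite -mulrA.
    apply: (chain_form_coercive _ _ (ltnW (ltn_ord k))).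
      by rewrite mulr_ge0 ?sqrtr_ge0.
    rewrite exprMn !sqr_sqrtr ?ler0n ?normr_ge0//; apply: (le_trans tK).
    by rewrite ler_wpM2r// ler_norm.
  by rewrite sumr_const card_ord -[X in _ <= X]mulrA mulr_natl.
have p2 k : 0 < (2 : R) ^+ k by rewrite exprn_gt0.
(* Ensures that eventually [chain_term] is in its nonzero branch: the sum of the [N_k] is
   [n - n / 2^d] plus a deviation of smaller order. *)
have sumle : \forall t \near F, (\sum_(k < d) (t : nat * (nat -> nat)).2 k <= t.1)%N.
  have h : 0 < ((2 : R) ^+ d)^-1 by rewrite invr_gt0.
  have H' : \forall t \near F, (\sum_(k < d) chain_dev R t.1 t.2 k) / t.1%:R <=
    ((2 : R) ^+ d)^-1 by apply: (cvgr_le _ sumdev).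
  near=> t; have t0 : (0 < t.1)%N by near: t.
  have : (\sum_(k < d) chain_dev R t.1 t.2 k) / t.1%:R <= ((2 : R) ^+ d)^-1 by near: t.
  rewrite ler_pdivrMr ?ltr0n// => H.
  by rewrite -(ler_nat R); move: H; rewrite chain_dev_sum mulrC; lra.
have restc : (chain_rest d t.1 t.2)%:R / t.1%:R @[t --> F] --> ((2 : R) ^+ d)^-1.
  apply: (@cvg_near_eq _ _ _ (fun t => ((2 : R) ^+ d)^-1 -
    (\sum_(k < d) chain_dev R t.1 t.2 k) / t.1%:R)); last first.
    rewrite -[X in _ --> X]subr0.
    by apply: cvgB; [exact: cvg_cst|exact: sumdev].
  near=> t.
  have n0 : 0 < t.1%:R :> R by rewrite ltr0n; near: t.
  rewrite chain_restE /=; last by near: t.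
  move: (\sum_(k < d) _) (2 ^+ d) (lt0r_neq0 (p2 d)) => S y y0.
  by field; rewrite y0 gt_eqF.
have L1 k : (k < d)%N -> Num.sqrt t.1%:R * binp R (t.2 k) (t.2 k.+1) *
    expR (2 ^+ k.+1 * bdev R (t.2 k) (t.2 k.+1) ^+ 2 / (2 * t.1%:R)) @[t --> F]
    --> Num.sqrt (2 ^+ k.+1) * binp_const R.
  move=> kd; apply: (@binp_scaled_cvg _ _ _ _ _ _ _ K) => //; first exact/fc/ltnW.
  apply: filterS sK => t; apply: le_trans.
  rewrite -(chain_dev_eps R t.1); apply: le_trans (chain_form_eps_le _ kd).
  by rewrite ler_peMl ?sqr_ge0// exprn_ege1// ler1n.
have L2 : Num.sqrt t.1%:R * binp R (chain_rest d t.1 t.2) (t.2 d) *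
    expR (2 ^+ d * bdev R (chain_rest d t.1 t.2) (t.2 d) ^+ 2 / (2 * t.1%:R)) @[t --> F]
    --> Num.sqrt (2 ^+ d) * binp_const R.
  apply: (@binp_scaled_cvg _ _ _ _ _ _ _ K) => //.
  near=> t.
  have tK : chain_sqr R d t.1 t.2 <= K * t.1%:R by near: t.
  apply: le_trans tK; rewrite -sqrrN -(chain_dev_eta R); last by near: t.
  apply: le_trans (chain_form_eta_le _ _).
  by rewrite ler_peMl ?sqr_ge0// exprn_ege1// ler1n.
have L3 : (t.2 d)%:R / (chain_rest d t.1 t.2)%:R @[t --> F] --> (1 / 2 : R).
  have h0 : ((2 : R) ^+ d)^-1 != 0 by rewrite invr_neq0// gt_eqF.
  have -> : 1 / 2 = ((2 : R) ^+ d.+1)^-1 * ((2 : R) ^+ d)^-1^-1.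
    by rewrite exprS; field; rewrite gt_eqF.
  apply: cvg_near_eq (cvgM (fc d (leqnn d)) (cvgV h0 restc)); near=> t => /=.
  have n0 : 0 < t.1%:R :> R by rewrite ltr0n; near: t.
  by rewrite invf_div mulrA divfK// gt_eqF.
have restpos : \forall t \near F, (0 < chain_rest d t.1 t.2)%N.
  have h0 : 0 < ((2 : R) ^+ d)^-1 by rewrite invr_gt0.
  have H' : \forall t \near F, 0 < (chain_rest d t.1 t.2)%:R / t.1%:R :> R.
    by apply: (cvgr_gt _ restc).
  apply: filterS H' => t.
  by rewrite lt0n; apply: contraL => /eqP ->; rewrite mul0r ltxx.
apply: cvg_near_eq (cvgM (cvg_prod FF L1) (cvgM L2 L3)); near=> t => /=.
have sle : (\sum_(k < d) t.2 k <= t.1)%N by near: t.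
have n0 : 0 < t.1%:R :> R by rewrite ltr0n; near: t.
rewrite /chain_term sle bin_last_ratio; last by near: t.
have -> : expR (1 / 2 * chain_energy t) =
    \prod_(k < d) expR (2 ^+ k.+1 * bdev R (t.2 k) (t.2 k.+1) ^+ 2 / (2 * t.1%:R)) *
    expR (2 ^+ d * bdev R (chain_rest d t.1 t.2) (t.2 d) ^+ 2 / (2 * t.1%:R)).
  rewrite -expR_sum -expRD -mulr_suml /chain_energy chain_sqrE//; congr expR.
  move: (\sum_(k < d) _) => S.
  by field; rewrite gt_eqF.
rewrite 2!big_split /= prodr_const card_ord (exprSr (Num.sqrt _) d).
by ring.
Unshelve. all: by end_near. Qed.

End Limits.

(** * Summation over [j], uniformly in [s] *)

Section UniformEstimate.
Variables (R : realType) (d : nat).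
Implicit Types s : multinom d.

Definition dev_vec n s : 'rV[R]_d := svec R s - n%:R *: mvec R d.

Lemma chain_dev_vec n s j (k : 'I_d) :
  chain_dev R n (chain s j) k - chain_dev R n (chain s j) k.+1 = dev_vec n s 0 k.
Proof.
rewrite /chain_dev chainS natrD /dev_vec !mxE addn1 (exprS _ k.+1).
have : (2 : R) ^+ k.+1 != 0 by rewrite expf_neq0// pnatr_eq0.
by move: (2 ^+ k.+1) => y y0; field.
Qed.

Lemma Hquad_ge0 (v : 'rV[R]_d) : 0 <= Hquad v.
Proof. by have [a _ <-] := Hquad_center v; exact: chain_form_ge0. Qed.

Lemma Hcenter_le (v : 'rV[R]_d) (D : R) : 0 <= D -> Hquad v <= D ^+ 2 ->
  `|Hcenter v| <= d.+2%:R * 4 ^+ d * D.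
Proof.
move=> D0; have [a <- <-] := Hquad_center v => aD.
exact: chain_form_coercive aD _ (leqnn d).
Qed.

Definition chain_center n s : R := n%:R / 2 ^+ d.+1 + Hcenter (dev_vec n s).

Lemma chain_energy_decomp n s j : chain_energy R d (n, chain s j) =
  Hquad (dev_vec n s) / n%:R +
  form_top R d * (j%:R - chain_center n s) ^+ 2 / n%:R.
Proof.
rewrite /chain_energy /chain_sqr /= (chain_form_Hquad (chain_dev_vec n s j)).
rewrite mulrDl /chain_dev chain_end /chain_center; congr (_ + _ * _ / _).
by rewrite opprD addrA.
Qed.

Lemma gaussE n s : gauss R n s = expR (- (Hquad (dev_vec n s) / (2 * n%:R))).
Proof. by []. Qed.

Lemma gauss_le1 n s : gauss R n s <= 1.
Proof. by rewrite gaussE expR_le1 oppr_le0 divr_ge0 ?Hquad_ge0. Qed.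

Lemma natr_ge_sqrt (x : R) n : (Num.trunc (x ^+ 2) < n)%N -> x <= Num.sqrt n%:R.
Proof.
move=> xn; rewrite (le_trans (ler_norm _))// -sqrtr_sqr ler_wsqrtr//.
by apply: le_trans (ltW (truncnS_gt _)) _; rewrite ler_nat.
Qed.

Definition lattice_mass n s : R := (Num.sqrt n%:R)^-1 *
  \sum_(j < n.+1) expR (- (form_top R d / 2 * (j%:R - chain_center n s) ^+ 2 / n%:R)).

(** The factor [gauss] is essential: for remote [s] the centre may leave the range of [j], and the
    mass alone need not converge. If [Hquad <= K n] the centre is well inside; otherwise
    [gauss <= exp (- K / 2)] while the mass stays bounded. *)
Lemma lattice_mass_unif (e : R) : 0 < e -> exists n0, forall n s, (n0 <= n)%N ->
  `|gauss R n s * lattice_mass n s - gauss R n s * Num.sqrt (pi / (form_top R d / 2))| <= e.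
Proof.
move=> e0; have a0 : 0 < form_top R d / 2 by rewrite divr_gt0// form_top_gt0.
set P := Num.sqrt _; have P0 : 0 <= P by exact: sqrtr_ge0.
have [C C0 HC] := lattice_gauss_le a0.
have [X X0 [n1 Hn1]] := lattice_gauss_lim a0 e0.
(* Chosen so that [exp x >= 1 + x] gives [exp (- K / 2) * (C + P) <= e]. *)
pose K := 2 * (C + P) / e.
have K0 : 0 < K by rewrite divr_gt0// mulr_gt0// ltr_wpDr.
pose M0 : R := d.+2%:R * 4 ^+ d.
have M00 : 0 < M0 by rewrite mulr_gt0 ?exprn_gt0.
pose Y := X + M0 * Num.sqrt K.
have Y0 : 0 < Y by rewrite ltr_wpDr// mulr_ge0 ?sqrtr_ge0// ltW.
exists (maxn n1 (Num.trunc ((2 ^+ d.+1 * Y) ^+ 2)).+1) => n s.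
rewrite geq_max => /andP[nn1 nn2].
have n0 : (0 < n)%N by apply: leq_trans nn2.
have np : 0 < n%:R :> R by rewrite ltr0n.
have s0 : 0 < Num.sqrt n%:R :> R by rewrite sqrtr_gt0.
have nY := natr_ge_sqrt nn2.
have p2 : 0 < (2 : R) ^+ d.+1 by rewrite exprn_gt0.
have g0 : 0 <= gauss R n s by exact: expR_ge0.
rewrite -mulrBr normrM (ger0_norm g0).
have [small|big] := leP (Hquad (dev_vec n s)) (K * n%:R).
  suff H : `|lattice_mass n s - P| <= e.
    by apply: le_trans H; rewrite ler_piMl// gauss_le1.
  have ctr : `|Hcenter (dev_vec n s)| <= M0 * (Num.sqrt K * Num.sqrt n%:R).
    apply: Hcenter_le; first by rewrite mulr_ge0 ?sqrtr_ge0.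
    by rewrite exprMn !sqr_sqrtr ?ler0n ?(ltW K0).
  have Yn : Y * Num.sqrt n%:R <= n%:R / 2 ^+ d.+1.
    rewrite ler_pdivlMr// -[X in _ <= X]sqr_sqrtr ?ler0n// expr2.
    have -> : Y * Num.sqrt n%:R * 2 ^+ d.+1 = 2 ^+ d.+1 * Y * Num.sqrt n%:R by ring.
    by rewrite ler_pM2r.
  have half : n%:R / 2 ^+ d.+1 <= n%:R / 2 :> R.
    rewrite ler_pM2l// lef_pV2 ?posrE// exprS ler_peMr// exprn_ege1// ler1n//.
  move: ctr; rewrite ler_norml => /andP[c1 c2].
  apply: Hn1 => //; rewrite /chain_center.
    by move: Yn; rewrite /Y mulrDl -mulrA; move: (n%:R / 2 ^+ d.+1) => ? ?; lra.
  rewrite -[n.+1%:R]natr1.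
  by move: Yn half; rewrite /Y mulrDl -mulrA; move: (n%:R / 2 ^+ d.+1) => ? ? ?; lra.
have m1 : `|lattice_mass n s - P| <= C + P.
  apply: le_trans (ler_normB _ _) _; rewrite (ger0_norm P0) lerD2r ger0_norm; last first.
    by rewrite mulr_ge0 ?invr_ge0 ?sqrtr_ge0// sumr_ge0// => j _; exact: expR_ge0.
  by rewrite /lattice_mass mulrC ler_pdivrMr// HC.
apply: (@le_trans _ _ (expR (- (K / 2)) * (C + P))).
  apply: ler_pM => //; rewrite gaussE ler_expR lerN2 ler_pdivlMr ?mulr_gt0//.
  by move: big; lra.
rewrite expRN mulrC ler_pdivrMr ?expR_gt0//.
have := ler_wpM2l (ltW e0) (expR_ge1Dx (K / 2)).
have -> : e * (1 + K / 2) = e + (C + P) by rewrite /K; field; rewrite gt_eqF.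
by lra.
Qed.

Definition limit_const : R := chain_const R d * Num.sqrt (pi / (form_top R d / 2)).

Lemma chain_const_gt0 : 0 < chain_const R d.
Proof.
have k0 := binp_const_gt0 R.
rewrite mulr_gt0//; last by rewrite !mulr_gt0 ?sqrtr_gt0 ?exprn_gt0.
by apply: prodr_gt0 => k _; rewrite mulr_gt0 ?sqrtr_gt0 ?exprn_gt0.
Qed.

Lemma limit_const_gt0 : 0 < limit_const.
Proof.
rewrite mulr_gt0 ?chain_const_gt0// sqrtr_gt0 divr_gt0 ?pi_gt0//.
by rewrite divr_gt0// form_top_gt0.
Qed.

Lemma coef_unif (e : R) : 0 < e -> exists n0, forall n s, (n0 <= n)%N ->
  `|Num.sqrt n%:R ^+ d * (mcoeff s (coefs (compGF R d) n) / 2 ^+ n)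
    - limit_const * gauss R n s| <= e.
Proof.
move=> e0.
have [C0 C00 HC0] := chain_term_domination R d.
have k0 := chain_const_gt0.
pose c0 : R := (16 * 2 ^+ d)^-1.
have p1 : 1 <= (2 : R) ^+ d by rewrite exprn_ege1// ler1n.
have c00 : 0 < c0 by rewrite invr_gt0 mulr_gt0// (lt_le_trans ltr01).
have c02 : c0 <= 1 / 2.
  by rewrite div1r lef_pV2 ?posrE//; lra.
pose f (t : nat * (nat -> nat)) := Num.sqrt t.1%:R ^+ d.+1 * chain_term R d t.1 t.2.
pose g (t : nat * (nat -> nat)) := chain_const R d * expR (- (1 / 2 * chain_energy R d t)).
have q0 := @chain_energy_ge0 R d.
have Hf t : `|f t| <= (C0 + chain_const R d) * expR (- (c0 * chain_energy R d t)).
  rewrite ger0_norm ?mulr_ge0 ?exprn_ge0 ?sqrtr_ge0 ?chain_term_ge0//.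
  apply: (le_trans (HC0 t.1 t.2)).
  by rewrite ler_wpM2r ?expR_ge0// lerDl ltW.
have Hg t : `|g t| <= (C0 + chain_const R d) * expR (- (c0 * chain_energy R d t)).
  rewrite ger0_norm; last by apply: mulr_ge0; [exact: ltW|exact: expR_ge0].
  apply: ler_pM; [exact: ltW|exact: expR_ge0|by rewrite lerDr ltW|].
  by rewrite ler_expR lerN2 ler_wpM2r.
have fg K : (f t - g t) @[t --> unif_oo fst [set t | chain_energy R d t <= K]] --> (0 : R).
  apply: (@ratio_to_diff _ _ _ _ f (fun t => 1 / 2 * chain_energy R d t)).
    by near=> t; rewrite mulr_ge0.
  exact: chain_term_cvg.
have a0 := form_top_gt0 R d.
(* The rate in [j] of the error weight left by [dominated_patch]; the [Hquad] part of the energy is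
   nonnegative and is dropped there. *)
have al0 : 0 < c0 / 2 * form_top R d by rewrite mulr_gt0// divr_gt0.
have [C1 C10 H1] := lattice_gauss_le al0.
have e1 : 0 < e / 2 / C1 by rewrite !divr_gt0.
have e2 : 0 < e / 2 / chain_const R d by rewrite !divr_gt0.
have [n1 Hn1] := dominated_patch (addr_gt0 C00 k0) c00 q0 Hf Hg fg e1.
have [n2 Hn2] := lattice_mass_unif e2.
exists (maxn (maxn n1 n2) 1) => n s; rewrite !geq_max => /andP[/andP[nn1 nn2] n0].
have np : 0 < n%:R :> R by rewrite ltr0n.
have s0 : 0 < Num.sqrt n%:R :> R by rewrite sqrtr_gt0.
have Ef : Num.sqrt n%:R ^+ d * (mcoeff s (coefs (compGF R d) n) / 2 ^+ n) =
    (Num.sqrt n%:R)^-1 * \sum_(j < n.+1) f (n, chain s j).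
  rewrite coef_compGF mulr_suml !mulr_sumr; apply: eq_bigr => j _.
  rewrite comp_count_chain_term /f /= exprS !mulrA mulVf ?gt_eqF// mul1r//.
have Eg : (Num.sqrt n%:R)^-1 * \sum_(j < n.+1) g (n, chain s j) =
    chain_const R d * (gauss R n s * lattice_mass n s).
  rewrite /lattice_mass /g -mulr_sumr mulrCA; congr (_ * _).
  rewrite mulrCA; congr (_ * _); rewrite mulr_sumr; apply: eq_bigr => j _.
  rewrite gaussE -expRD chain_energy_decomp; congr expR.
  by field; rewrite gt_eqF.
have -> : limit_const * gauss R n s =
  chain_const R d * (gauss R n s * Num.sqrt (pi / (form_top R d / 2))).
  by rewrite /limit_const; ring.
rewrite Ef.
set U := _ * \sum_(j < n.+1) f _ in Ef *.
set V := _ * \sum_(j < n.+1) g _ in Eg.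
have UV : `|U - V| <= e / 2.
  rewrite /U /V -mulrBr normrM normfV (gtr0_norm s0) mulrC ler_pdivrMr// -sumrB.
  apply: le_trans (ler_norm_sum _ _ _) _.
  apply: (@le_trans _ _ (\sum_(j < n.+1) e / 2 / C1 *
    expR (- (c0 / 2 * form_top R d * (j%:R - chain_center n s) ^+ 2 / n%:R)))).
    apply: ler_sum => j _; apply: (le_trans (Hn1 (n, chain s j) nn1)).
    rewrite ler_wpM2l ?(ltW e1)// ler_expR lerN2 chain_energy_decomp.
    move: (form_top R d) (chain_center n s) => a c.
    rewrite (mulrDr (c0 / 2)) [X in X <= _](_ : _ = c0 / 2 *
      (a * (j%:R - c) ^+ 2 / n%:R)); last by ring.
    rewrite lerDr; apply: mulr_ge0; first by rewrite divr_ge0// ltW.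
    by rewrite divr_ge0 ?Hquad_ge0.
  rewrite -mulr_sumr; apply: le_trans (ler_wpM2l (ltW e1) (H1 n n.+1 (chain_center n s) n0)) _.
  by rewrite mulrA divfK// gt_eqF.
rewrite -[U](subrK V) Eg -addrA -mulrBr; apply: le_trans (ler_normD _ _) _.
rewrite [e in _ <= e](_ : e = e / 2 + e / 2); last by field.
rewrite -{1}Eg lerD// normrM (gtr0_norm k0) mulrC -ler_pdivlMr//.
exact: Hn2.
Unshelve. all: by end_near. Qed.

End UniformEstimate.

(** * Identification of the constant and the two limits *)

Section Normalisation.
Variables (R : realType) (d : nat).

Lemma ln_sqrt (x : R) : 0 < x -> ln (Num.sqrt x) = ln x / 2.
Proof. by move=> x0; rewrite -powR12_sqrt ?ltW// ln_powR mulrC. Qed.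

Lemma ln_binp_const : ln (binp_const R) = (ln 2 - ln pi) / 2.
Proof.
have k0 := binp_const_gt0 R.
have : ln (binp_const R ^+ 2) = ln 2 - ln pi.
  by rewrite binp_const_sqr ln_div ?posrE ?pi_gt0.
by rewrite lnXn// mulr2n => <-; field.
Qed.

Lemma ln_chain_prod m :
  ln (\prod_(k < m) (Num.sqrt (2 ^+ k.+1) * binp_const R)) =
  m%:R * (m%:R + 1) / 4 * ln 2 + m%:R * ln (binp_const R).
Proof.
have k0 := binp_const_gt0 R.
elim: m => [|m IH]; first by rewrite big_ord0 ln1; ring.
have p0 : 0 < \prod_(k < m) (Num.sqrt (2 ^+ k.+1) * binp_const R).
  by apply: prodr_gt0 => k _; rewrite mulr_gt0 ?sqrtr_gt0 ?exprn_gt0.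
have s0 : 0 < Num.sqrt (2 ^+ m.+1) :> R by rewrite sqrtr_gt0 exprn_gt0.
rewrite big_ord_recr /= lnM ?posrE ?mulr_gt0// IH lnM ?posrE//.
rewrite ln_sqrt ?exprn_gt0// lnXn// -[ln 2 *+ _]mulr_natr -[m.+1%:R]natr1.
by field.
Qed.

(** Taking logarithms turns the half-integral powers into a linear identity in [ln 2], [ln pi] and
    [ln (form_top R d)]. *)
Lemma limit_constE : limit_const R d =
  2 `^ ((d ^ 2)%:R / 4 + 7 * d%:R / 4 + 1) /
  (2 * (2 * pi) `^ (d%:R / 2) * Num.sqrt ((d ^ 2 + 4 * d + 6)%:R * 2 ^+ d - 2)).
Proof.
have k0 := binp_const_gt0 R; have a0 := form_top_gt0 R d; have p0 := pi_gt0 R.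
rewrite -/(form_top R d).
have s0 : 0 < Num.sqrt (form_top R d) by rewrite sqrtr_gt0.
have w0 : 0 < (2 * pi) `^ (d%:R / 2) :> R by rewrite powR_gt0 ?mulr_gt0.
have q0 : 0 < \prod_(k < d) (Num.sqrt (2 ^+ k.+1) * binp_const R).
  by apply: prodr_gt0 => k _; rewrite mulr_gt0 ?sqrtr_gt0 ?exprn_gt0.
apply: ln_inj; rewrite ?posrE ?limit_const_gt0//.
  by rewrite divr_gt0 ?powR_gt0// !mulr_gt0.
rewrite ln_div ?posrE ?powR_gt0 ?mulr_gt0//.
rewrite ln_powR lnM ?posrE ?mulr_gt0// lnM ?posrE// ln_powR lnM ?posrE// ln_sqrt//.
rewrite /limit_const /chain_const.
have t0 : 0 < Num.sqrt (pi / (form_top R d / 2)) by rewrite sqrtr_gt0 !divr_gt0.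
have u0 : 0 < Num.sqrt (2 ^+ d) :> R by rewrite sqrtr_gt0 exprn_gt0.
rewrite lnM ?posrE ?mulr_gt0// lnM ?posrE ?mulr_gt0// ln_chain_prod.
rewrite lnM ?posrE ?mulr_gt0// lnM ?posrE ?mulr_gt0//.
rewrite !ln_sqrt ?exprn_gt0 ?divr_gt0// lnXn// ln_div ?posrE ?divr_gt0// ln_div ?posrE//.
rewrite div1r lnV ?posrE// ln_binp_const -[ln 2 *+ _]mulr_natr natrX.
by field.
Qed.

Lemma A_E n : (0 < n)%N ->
  A_ R d n = 2 ^+ n / Num.sqrt n%:R ^+ d * limit_const R d.
Proof.
move=> n0; rewrite /A_ -limit_constE powRN; congr (_ / _ * _).
by rewrite mulrC powRrM powR12_sqrt// powR_mulrn ?sqrtr_ge0.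
Qed.

Lemma A_gt0 n : (0 < n)%N -> 0 < A_ R d n.
Proof.
by move=> n0; rewrite A_E// mulr_gt0 ?limit_const_gt0// divr_gt0 ?exprn_gt0// sqrtr_gt0 ltr0n.
Qed.

Lemma coef_ratio_unif (e : R) : 0 < e -> exists n0, forall n (s : multinom d),
  (n0 <= n)%N -> (0 < n)%N /\
  `|mcoeff s (coefs (compGF R d) n) / A_ R d n - gauss R n s| <= e.
Proof.
move=> e0; have l0 := limit_const_gt0 R d.
have [n0 H] := coef_unif d (mulr_gt0 e0 l0).
exists (maxn n0 1) => n s; rewrite geq_max => /andP[nn n1]; split=> //.
have s0 : 0 < Num.sqrt n%:R :> R by rewrite sqrtr_gt0 ltr0n.
have -> : mcoeff s (coefs (compGF R d) n) / A_ R d n - gauss R n s =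
  (Num.sqrt n%:R ^+ d * (mcoeff s (coefs (compGF R d) n) / 2 ^+ n)
    - limit_const R d * gauss R n s) / limit_const R d.
  rewrite A_E//.
  have : Num.sqrt n%:R ^+ d != 0 :> R by rewrite expf_neq0// gt_eqF.
  have : (2 : R) ^+ n != 0 by rewrite expf_neq0.
  move: (Num.sqrt n%:R ^+ d) (2 ^+ n) (gauss R n s) (mcoeff _ _) => x y z w y0 x0.
  by field; rewrite x0 y0 gt_eqF.
by rewrite normrM normfV (gtr0_norm l0) ler_pdivrMr// H.
Qed.

Lemma Hquad_bounded : exists2 B : R, 0 < B & forall v : 'rV[R]_d,
  (forall k, `|v 0 k| <= 1) -> Hquad v <= B.
Proof.
exists (1 + \sum_(k < d) \sum_(i < d) `|invmx (Hmx R d) i k|).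
  by rewrite ltr_wpDr// sumr_ge0// => k _; rewrite sumr_ge0.
move=> v v1; rewrite /Hquad mxE ler_wpDl//; apply: ler_sum => k _.
rewrite mxE; apply: le_trans (ler_norm _) _; rewrite normrM mxE.
apply: (@le_trans _ _ `|\sum_(i < d) v 0 i * invmx (Hmx R d) i k|).
  by rewrite ler_piMr// v1.
apply: le_trans (ler_norm_sum _ _ _) _; apply: ler_sum => i _.
by rewrite normrM ler_piMl// v1.
Qed.

(** The integer part of [n m], coordinatewise. Its deviation stays bounded as [n] grows, so [gauss]
    tends to 1 along it. *)
Definition mode n : multinom d :=
  Multinom [tuple Num.trunc (n%:R / 2 ^+ k.+2 : R) | k < d].

Lemma dev_vec_mode n k : `|dev_vec R n (mode n) 0 k| <= 1.
Proof.
rewrite /dev_vec !mxE addn1 /mode mnmE.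
have x0 : 0 <= n%:R / 2 ^+ k.+2 :> R by rewrite divr_ge0// exprn_ge0.
have /andP[h1 h2] := truncn_itv x0.
rewrite -[_.+1%:R]natr1 in h2.
by rewrite ler_norml; apply/andP; split; lra.
Qed.

Lemma gauss_mode_cvg : gauss R n (mode n) @[n --> \oo] --> (1 : R).
Proof.
have [B B0 HB] := Hquad_bounded.
apply: (@squeeze_cvgr _ _ _ _ (fun n : nat => 1 - B * n%:R^-1) (fun=> 1)).
- near=> n; rewrite gauss_le1 andbT gaussE.
  have n0 : 0 < n%:R :> R by rewrite ltr0n; near: n; exists 1%N.
  apply: le_trans (expR_ge1Dx _); rewrite lerD2l lerN2 invfM mulrA.
  rewrite ler_pM2r ?invr_gt0//.
  have := HB _ (dev_vec_mode n); have := @Hquad_ge0 R d (dev_vec R n (mode n)); lra.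
- rewrite -[X in _ --> X]subr0 -(mulr0 B); apply: cvgB; first exact: cvg_cst.
  apply: cvgM; first exact: cvg_cst.
  apply/gtr0_cvgV0; last exact: cvgr_idn.
  by near=> n; rewrite ltr0n; near: n; exists 1%N.
- exact: cvg_cst.
Unshelve. all: by end_near. Qed.

Lemma mcoeff_le_maxcoef (p : mpoly d R) s : mcoeff s p <= maxcoef p.
Proof.
have [sp|sp] := boolP (s \in msupp p).
  exact: (@le_bigmax_seq _ _ _ _ _ _ predT (fun s => mcoeff s p)).
by rewrite (memN_msupp_eq0 sp) /maxcoef bigmax_ge_id.
Qed.

(** The lower bound is the coefficient at [mode n]; the upper bound combines the uniform estimate
    with [gauss <= 1]. *)
Lemma maxcoef_cvg : maxcoef (coefs (compGF R d) n) / A_ R d n @[n --> \oo] --> (1 : R).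
Proof.
apply/cvgrPdist_le => e e0; have e2 : 0 < e / 2 by rewrite divr_gt0.
have [n0 H] := coef_ratio_unif e2.
have /cvgrPdist_le/(_ _ e2) G := gauss_mode_cvg.
near=> n.
have nn : (n0 <= n)%N by near: n; exists n0.
have Gn : `|1 - gauss R n (mode n)| <= e / 2 by near: n.
have [np Hm] := H n (mode n) nn; have A0 := A_gt0 np.
have lower : 1 - e <= maxcoef (coefs (compGF R d) n) / A_ R d n.
  apply: (@le_trans _ _ (mcoeff (mode n) (coefs (compGF R d) n) / A_ R d n)).
    by move: Hm Gn; rewrite !ler_norml => /andP[? ?] /andP[? ?]; lra.
  by rewrite ler_pM2r ?invr_gt0// mcoeff_le_maxcoef.
have upper : maxcoef (coefs (compGF R d) n) / A_ R d n <= 1 + e.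
  rewrite ler_pdivrMr//; apply: bigmax_le => [|s _].
    by rewrite mulr_ge0 ?(ltW A0)// addr_ge0// ltW.
  rewrite -ler_pdivrMr//; have [_] := H n s nn; have := gauss_le1 R n s.
  by rewrite ler_norml => ? /andP[? ?]; lra.
by rewrite ler_norml; apply/andP; split; lra.
Unshelve. all: by end_near. Qed.

(** The uniform estimate makes the extended supremum finite for large [n], and the convergence can
    then be checked on its real value. *)
Lemma sup_cvg0 :
  ereal_sup [set `| mcoeff s (coefs (compGF R d) n) / A_ R d n
                     - gauss R n s |%:E | s in [set: multinom d]]
     @[n --> \oo] --> (0 : \bar R)%E.
Proof.
pose S n := [set `| mcoeff s (coefs (compGF R d) n) / A_ R d n
  - gauss R n s |%:E | s in [set: multinom d]].
have S0 n : (0 <= ereal_sup (S n))%E.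
  apply: le_trans (ereal_sup_ubound _); last by exists mnm0.
  by rewrite lee_fin.
have Se (e : R) : 0 < e -> \forall n \near \oo, (ereal_sup (S n) <= e%:E)%E.
  move=> e0; have [n0 H] := coef_ratio_unif e0; exists n0 => // n nn.
  apply: ge_ereal_sup => _ [s _ <-]; rewrite lee_fin.
  by have [] := H n s nn.
have fin n (e : R) : (ereal_sup (S n) <= e%:E)%E -> ereal_sup (S n) \is a fin_num.
  move=> le; rewrite ge0_fin_numE//; exact: le_lt_trans le (ltry _).
apply/fine_cvgP; split.
  by have := Se 1 ltr01; apply: filterS => n; exact: fin.
apply/cvgr0Pnorm_le => e e0; have := Se e e0; apply: filterS => n le.
have fi := fin _ _ le; change (`|fine (ereal_sup (S n))| <= e).
by rewrite ger0_norm ?fine_ge0// -lee_fin fineK.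
Qed.

End Normalisation.

Theorem theorem7 (R : realType) (d : nat) (hd : (1 <= d)%N) :
  (maxcoef (coefs (compGF R d) n) / A_ R d n @[n --> \oo] --> (1 : R)) /\
  (ereal_sup [set `| mcoeff s (coefs (compGF R d) n) / A_ R d n
                     - gauss R n s |%:E | s in [set: multinom d]]
     @[n --> \oo] --> (0 : \bar R)%E).
Proof. by split; [exact: maxcoef_cvg|exact: sup_cvg0]. Qed.
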